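(* Let $\varepsilon>0$ be a constant and let $k=k_n$ be a sequence of integers such that eventually $\varepsilon\log n\le k\le n^{1/3-\varepsilon}$. Then there exists a sequence $m=m_n$ such that asymptotically almost surely $$\gamma(\mathcal{G}(n,m))=k \qquad\text{and}\qquad b(\mathcal{G}(n,m))=\Theta(\Delta(\mathcal{G}(n,m)))=\Theta(m/n).$$
   Context: $\mathcal{G}(n,m)$ denotes the random graph chosen uniformly at random among all graphs on vertex set $[n]=\{1,\dots,n\}$ with exactly $m$ edges (equivalently, the $m$-th graph of the Erdős–Rényi random graph process, which adds the edges of $K_n$ one at a time in a uniformly random order). A dominating set of a graph $G=(V,E)$ is a set $D\subseteq V$ such that every vertex not in $D$ has a neighbour in $D$; the domination number $\gamma(G)$ is the minimum size of a dominating set. The bondage number of a graph with at least one edge is $b(G)=\min\{|B|: B\subseteq E,\ \gamma(G-B)>\gamma(G)\}$. $\Delta(G)$ is the maximum degree. All logarithms are natural; asymptotics are as $n\to\infty$; ''eventually'' means for all but finitely many $n$; an event holds asymptotically almost surely (a.a.s.) if its probability tends to $1$. Functions hidden in $\Theta(\cdot)$ are positive. *)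

(* Defs.v *)
From HB Require Import structures.
From mathcomp Require Import all_boot all_order all_algebra.
From mathcomp Require Import all_classical all_reals all_analysis.
Set Implicit Arguments.
Unset Strict Implicit.
Unset Printing Implicit Defensive.
Import Order.TTheory GRing.Theory Num.Theory.
Import numFieldNormedType.Exports.

Local Open Scope ring_scope.

(* A simple graph on the vertex type T is given by its edge set E, a set of
   two-element subsets of T; the requirement that every edge has exactly two
   elements is imposed by [Gnm] below. *)
Section Graphs.
Variable T : finType.
Implicit Types (E B : {set {set T}}) (D : {set T}) (u v : T).

Definition all_edges : {set {set T}} := [set e : {set T} | #|e| == 2%N].

Definition adj E u v : bool := (u != v) && ([set u; v]%SET \in E).

Definition dominating E D : bool :=
  [forall v, (v \notin D) ==> [exists u, (u \in D) && adj E u v]].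

(* The full vertex set is always dominating, so the minimum is attained. *)
Definition domination_number E : nat :=
  #|[arg min_(D < [set: T]%SET | dominating E D) #|D|]|.

(* If E is nonempty then B = E qualifies, so this is a genuine minimum; if E
   is empty there is no admissible B and the value is the junk value 0. *)
Definition bondage_number E : nat :=
  #|[arg min_(B < E | (B \subset E) &&
       (domination_number E < domination_number (E :\: B))%N) #|B|]|.

Definition max_degree E : nat := (\max_(v : T) #|[set u | adj E u v]%SET|)%N.

End Graphs.

Definition Gnm (n m : nat) : {set {set {set 'I_n}}} :=
  [set E : {set {set 'I_n}} | (E \subset all_edges 'I_n) && (#|E| == m)].

(* The uniform probability; when 'C(n, 2) < m there is no graph and every event
   has value 0 / 0 = 0, so no event can hold a.a.s. along such m. *)
Definition Gnm_prob (R : realType) (n m : nat)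
    (A : pred {set {set 'I_n}}) : R :=
  #|[set E in Gnm n m | A E]%SET|%:R / #|Gnm n m|%:R.

Definition aas (R : realType) (m : nat -> nat)
    (A : forall n, pred {set {set 'I_n}}) : Prop :=
  ((fun n => Gnm_prob R (m n) (A n)) @ \oo --> (1 : R))%classic.

(* Main.v *)
(* Work in the binomial model G(n, p), a mixture of the models G(n, m): an event
   of probability 1 - o(1) there has probability 1 - o(1) in some G(n, m).  Let
   mu be the expected number of dominating k-sets, q = (1 - p) ^ k, and choose p
   so that mu is about n ^ 10; lowering k by one then multiplies the expectation
   by exp (- c (ln n) ^ 2), so no (k - 1)-set dominates.  For the rest, let Z_v
   be the number of dominating k-sets through v, and Y_uv the number of those
   through v, avoiding u, that contain at most s = delta ln n neighbours of u.
   A second moment computation over pairs of k-sets, sorted by the size of their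
   intersection, shows that sum_v (Z_v - k mu / n) ^ 2 is at most
   n ^ (- eps) (k / n) mu ^ 2 and sum_uv Y_uv ^ 2 at most n ^ (- eps / 2) times
   mu ^ 2 k / n, up to constants; this is where k ^ 3 << n is needed.  Now delete
   a set B of at most L = c n ln n / k edges.  After discarding the few
   dominating sets through vertices with Z_v > 2 k mu / n, a set D that no longer
   dominates has lost all its edges to some u.  If there were at most s of them,
   D is counted by Y_uv with uv in B, and by Cauchy-Schwarz there are few such D;
   otherwise B has more than s edges between u and D, and double counting with
   the bound on Z_v shows that there are few such D as well.  Hence some k-set
   survives and the bondage number exceeds L, which is of the order of the
   maximum degree.  Conversely, isolating both ends of an edge raises the
   domination number, so the bondage number is at most twice the maximum
   degree. *)

Require Import Defs.
From HB Require Import structures.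
From mathcomp Require Import all_boot all_order all_algebra.
From mathcomp Require Import all_classical all_reals all_analysis.
From mathcomp Require Import zify ring lra.
Import Order.TTheory GRing.Theory Num.Theory.
Import numFieldNormedType.Exports.

Local Open Scope ring_scope.

Set Implicit Arguments.
Unset Strict Implicit.
Unset Printing Implicit Defensive.

(** * Elementary inequalities *)

Section Elementary.
Variable R : realType.

Lemma bin2_natr (m : nat) : (0 < m)%N ->
  'C(m, 2)%:R = m%:R * (m%:R - 1) / 2%:R :> R.
Proof.
move=> m0; have := mul_bin_diag m 1; rewrite bin1.
move=> /(congr1 (fun j => j%:R : R)).
by rewrite !natrM -subn1 natrB // => ->; field.
Qed.

Lemma expR1_le4 : expR 1 <= 4 :> R.
Proof.
have h : expR (-1) = expR (- (1/2)) * expR (- (1/2)) :> R.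
  by rewrite -expRD; congr expR; field.
have h2 := expR_ge1Dx (- (1/2) : R).
have h3 : 1 / 4 <= expR (-1) :> R by rewrite h; nra.
have h4 : expR (-1) * expR 1 = 1 :> R by rewrite -expRD addNr expR0.
have := expR_gt0 (1 : R); nra.
Qed.

Lemma expR_half_le2 : expR (1 / 2) <= 2 :> R.
Proof.
have h : expR 1 = expR (1/2) * expR (1/2) :> R.
  by rewrite -expRD; congr expR; field.
by have := expR1_le4; have := expR_gt0 (1 / 2 : R); rewrite h; nra.
Qed.

(** Squaring [1 + t / 2 <= exp (t / 2)] keeps the quadratic term that [1 + t <= exp t] loses. The
    lower bound is for the probability that a set dominates, which stands in the denominator of the
    pair correlation; the [x ^+ 2] lost in each factor costs only about [n q ^ 2] in the
    exponent. *)
Lemma expR_le_1B (x : R) : 0 <= x <= 1 / 8%:R -> expR (- (x + x ^+ 2)) <= 1 - x.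
Proof.
move=> /andP[x0 x8]; have e0 := expR_gt0 (x + x ^+ 2).
rewrite expRN -div1r ler_pdivrMr //.
have e : expR (x + x ^+ 2) = expR ((x + x ^+ 2) / 2) ^+ 2.
  by rewrite -expRM_natl; congr expR; field.
have h := expR_ge1Dx ((x + x ^+ 2) / 2).
have h2 : (1 + (x + x ^+ 2) / 2) ^+ 2 <= expR (x + x ^+ 2).
  by rewrite e; apply: lerXn2r; rewrite ?nnegrE ?expR_ge0 //; nra.
apply: (@le_trans _ _ ((1 - x) * (1 + (x + x ^+ 2) / 2) ^+ 2)); last first.
  by apply: ler_wpM2l => //; lra.
have -> : (1 - x) * (1 + (x + x ^+ 2) / 2) ^+ 2 =
  1 + x ^+ 2 * ((1 - x) * (1 + x) ^+ 2 / 4%:R - x) by field.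
by rewrite lerDl; apply: mulr_ge0; [exact: sqr_ge0|nra].
Qed.

(** The weight [i] is absorbed by doubling the ratio 1/4, while one factor [t] is kept, so that the
    sum over all overlap sizes is of order [t] and not merely bounded. *)
Lemma natr_exp_le (t : R) (i : nat) : 0 <= t <= 1 / 4%:R -> i%:R * t ^+ i <= 2 * t * (1 / 2) ^+ i.
Proof.
move=> /andP[t0 t4]; case: i => [|i]; first by rewrite mul0r mulr_ge0 ?mulr_ge0.
have e1 : i.+1%:R <= 2 ^+ i :> R by rewrite -natrX ler_nat ltn_expl.
have e2 : t ^+ i <= (1 / 4%:R) ^+ i by apply: lerXn2r; rewrite ?nnegrE //; lra.
have -> : 2 * t * (1 / 2) ^+ i.+1 = t * (2 ^+ i * (1 / 4%:R) ^+ i).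
  rewrite -exprMn exprS (_ : 2 * (1 / 4%:R) = 1 / 2 :> R); last by field.
  by field.
rewrite exprS mulrCA; apply: ler_wpM2l => //.
by apply: ler_pM; rewrite ?exprn_ge0.
Qed.

Lemma sum_half (m : nat) : \sum_(i < m) (1 / 2) ^+ i <= 2 :> R.
Proof.
suff -> : \sum_(i < m) (1 / 2) ^+ i = 2 - 2 * (1 / 2) ^+ m :> R.
  by rewrite gerBl mulr_ge0 // exprn_ge0.
elim: m => [|m IH]; first by rewrite big_ord0 expr0; ring.
by rewrite big_ord_recr /= IH exprS; field.
Qed.

End Elementary.

(** * Random subsets with independent elements *)

Section ProductMeasure.
Variables (R : realType) (I : finType) (w : I -> R).
Hypothesis w01 : forall i, 0 <= w i <= 1.
Implicit Types (A B J : {set I}) (f g : {set I} -> R).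

Definition pweight J : R := \prod_i (if i \in J then w i else 1 - w i).
Definition Ex f : R := \sum_(J : {set I}) pweight J * f J.

Lemma pweight_ge0 J : 0 <= pweight J.
Proof.
apply: prodr_ge0 => i _; have /andP[w0 w1] := w01 i.
by case: ifP => // _; rewrite subr_ge0.
Qed.

Lemma Ex_prod (F G : I -> R) :
  Ex (fun J => \prod_i (if i \in J then F i else G i)) =
  \prod_i (w i * F i + (1 - w i) * G i).
Proof.
rewrite bigA_distr; apply: eq_bigr => J _.
by rewrite /pweight -big_split /=; apply: eq_bigr => i _; case: ifP.
Qed.

Lemma Ex1 : Ex (fun=> 1) = 1.
Proof.
rewrite -[RHS](_ : \prod_(i : I) (w i * 1 + (1 - w i) * 1) = 1).
  rewrite -Ex_prod; apply: eq_bigr => J _; congr (_ * _).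
  by rewrite big1 // => i _; rewrite if_same.
by rewrite big1 // => i _; ring.
Qed.

Lemma ExZ c f : Ex (fun J => c * f J) = c * Ex f.
Proof. by rewrite /Ex big_distrr /=; apply: eq_bigr => J _; ring. Qed.

Lemma ExC c : Ex (fun=> c) = c.
Proof. by rewrite -[RHS]mulr1 -Ex1 -ExZ; apply: eq_bigr => J _; rewrite mulr1. Qed.

Lemma ExD f g : Ex (fun J => f J + g J) = Ex f + Ex g.
Proof. by rewrite /Ex -big_split /=; apply: eq_bigr => J _; ring. Qed.

Lemma ExB f g : Ex (fun J => f J - g J) = Ex f - Ex g.
Proof.
by rewrite /Ex -sumrB; apply: eq_bigr => J _; ring.
Qed.

Lemma Ex_sum (T : Type) (s : seq T) (P : pred T) (F : T -> {set I} -> R) :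
  Ex (fun J => \sum_(t <- s | P t) F t J) = \sum_(t <- s | P t) Ex (F t).
Proof.
rewrite /Ex exchange_big /=; apply: eq_bigr => J _.
by rewrite big_distrr.
Qed.

Lemma eq_Ex f g : f =1 g -> Ex f = Ex g.
Proof. by move=> fg; apply: eq_bigr => J _; rewrite fg. Qed.

Lemma le_Ex f g : (forall J, pweight J != 0 -> f J <= g J) -> Ex f <= Ex g.
Proof.
move=> fg; apply: ler_sum => J _; have [->|nz] := eqVneq (pweight J) 0.
  by rewrite !mul0r.
by rewrite ler_wpM2l ?pweight_ge0 ?fg.
Qed.

Definition swap A J B : {set I} := (J :&: A) :|: (B :\: A).

Lemma swapK A (x : {set I} * {set I}) :
  let s x := (swap A x.1 x.2, swap A x.2 x.1) in s (s x) = x.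
Proof.
case: x => J B /=; congr (_, _); apply/setP => i; rewrite !inE;
by case: (i \in A); rewrite ?andbF ?andbT ?orbF //=.
Qed.

Lemma pweight_swap A J B :
  pweight (swap A J B) * pweight (swap A B J) = pweight J * pweight B.
Proof.
rewrite /pweight -!big_split /=; apply: eq_bigr => i _; rewrite !inE.
by case: (i \in A); rewrite ?andbF ?andbT ?orbF //= mulrC.
Qed.

(* Exchanging the coordinates in [A] between two independent copies of the
   random set preserves their joint law. *)
Lemma Ex_indep A f g :
    (forall J, f (J :&: A) = f J) -> (forall J, g (J :\: A) = g J) ->
  Ex (fun J => f J * g J) = Ex f * Ex g.
Proof.
move=> fA gA.
have fs J B : f (swap A J B) = f J.
  rewrite -[LHS]fA -[RHS]fA; congr f; apply/setP => i; rewrite !inE.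
  by case: (i \in A); rewrite ?andbF ?andbT ?orbF.
have gs J B : g (swap A B J) = g J.
  rewrite -[LHS]gA -[RHS]gA; congr g; apply/setP => i; rewrite !inE.
  by case: (i \in A); rewrite ?andbF ?andbT ?orbF.
rewrite -[LHS]mulr1 -Ex1 /Ex !big_distrlr /=.
rewrite [LHS]pair_bigA [RHS]pair_bigA /=.
pose s (x : {set I} * {set I}) := (swap A x.1 x.2, swap A x.2 x.1).
rewrite [LHS](reindex_inj (inv_inj (swapK A : involutive s))) /=.
apply: eq_bigr => -[J B] _ /=; rewrite fs gs.
transitivity (pweight (swap A J B) * pweight (swap A B J) * (f J * g B)).
  by ring.
by rewrite pweight_swap; ring.
Qed.

Lemma Ex_indep_prod (T : finType) (P : pred T) (A : T -> {set I})
    (phi : T -> {set I} -> R) :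
    (forall t u, P t -> P u -> t != u -> [disjoint A t & A u]) ->
    (forall t J, P t -> phi t (J :&: A t) = phi t J) ->
  Ex (fun J => \prod_(t | P t) phi t J) = \prod_(t | P t) Ex (phi t).
Proof.
move=> dA phiA.
have: all P (enum P) by apply/allP => t; rewrite mem_enum.
have := enum_uniq P.
have -> : \prod_(t | P t) Ex (phi t) = \prod_(t <- enum P) Ex (phi t).
  by rewrite big_enum.
have -> : Ex (fun J => \prod_(t | P t) phi t J) =
          Ex (fun J => \prod_(t <- enum P) phi t J).
  by apply: eq_Ex => J; rewrite big_enum.
elim: (enum P) => [_ _|t s IH /= /andP[ts us] /andP[Pt Ps]].
  by rewrite big_nil -[RHS]Ex1; apply: eq_Ex => J; rewrite big_nil.
rewrite big_cons -IH // -(Ex_indep (A := A t)).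
- by apply: eq_Ex => J; rewrite big_cons.
- by move=> J; apply: phiA.
move=> J; apply: eq_big_seq => u su.
have Pu : P u by apply: (allP Ps).
have tu : t != u by apply: contraNneq ts => ->.
rewrite -[LHS](phiA u) // -[RHS](phiA u) //; congr phi.
apply/setP => i; rewrite !inE; case: (boolP (i \in A t)) => //= it.
by rewrite (disjointFr (dA _ _ Pt Pu tu) it) !andbF.
Qed.

(** The probability generating function of a binomial count: [c = 0] gives the probability of no
    element, and other [c] give the exponential moments for tail bounds. *)
Lemma Ex_gen (c : R) A :
  Ex (fun J => c ^+ #|A :&: J|) = \prod_(i in A) (1 - w i + w i * c).
Proof.
rewrite -[LHS](_ : Ex (fun J => \prod_i (if i \in J then
    (if i \in A then c else 1) else 1)) = _).
  rewrite Ex_prod [RHS]big_mkcond /=; apply: eq_bigr => i _.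
  by case: ifP => _; ring.
apply: eq_Ex => J; rewrite -prodr_const [RHS]big_mkcond /=.
by apply: eq_bigr => i _; rewrite inE andbC; case: (i \in J).
Qed.

End ProductMeasure.

(** * Domination and bondage *)

Section GraphFacts.
Variable T : finType.
Implicit Types (E B : {set {set T}}) (D S : {set T}) (u v : T).

Definition star u S : {set {set T}} := [set [set u; v]%SET | v in S].

Lemma setP2 u v u' v' :
  [set u; v]%SET = [set u'; v']%SET -> u = u' /\ v = v' \/ u = v' /\ v = u'.
Proof.
move=> e; have := set21 u v; have := set22 u v; rewrite e !inE.
have := set21 u' v'; have := set22 u' v'; rewrite -e !inE.
by do 4 case/orP => /eqP ?; subst; tauto.
Qed.

Lemma set2_inj u v v' : [set u; v]%SET = [set u; v']%SET -> v = v'.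
Proof. by case/setP2 => -[? ?]; subst. Qed.

Lemma card_star u S : #|star u S| = #|S|.
Proof. by rewrite card_in_imset // => v v' _ _; apply: set2_inj. Qed.

Lemma starU u D D' : star u (D :|: D') = star u D :|: star u D'.
Proof. exact: imsetU. Qed.

Lemma starS u D D' : D \subset D' -> star u D \subset star u D'.
Proof. exact: imsetS. Qed.

(** The source of all independence below: vertices outside [S] look at disjoint sets of potential
    edges into [S]. *)
Lemma star_disjoint u v S :
  u \notin S -> v \notin S -> u != v -> [disjoint star u S & star v S].
Proof.
move=> uS vS uv; rewrite -finset.setI_eq0; apply/eqP/setP => e; rewrite !inE.
apply/negbTE/negP => /andP[/imsetP[x xS ->] /imsetP[y yS]].
case/setP2 => -[? ?]; subst; last by rewrite yS in uS.
by rewrite eqxx in uv.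
Qed.

Lemma star_edges u S : u \notin S -> star u S \subset all_edges T.
Proof.
move=> uS; apply/fintype.subsetP => e /imsetP[v vS ->].
rewrite inE cards2; suff -> : u != v by [].
by apply: contraNneq uS => ->.
Qed.

Lemma dominatingP E D :
  reflect (forall u, u \notin D -> star u D :&: E != finset.set0)
          (dominating E D).
Proof.
apply: (iffP forallP) => [dom u uD|dom u].
  have /implyP/(_ uD)/existsP[v /andP[vD /andP[_ vuE]]] := dom u.
  apply/set0Pn; exists [set v; u]%SET; rewrite inE vuE andbT.
  by apply/imsetP; exists v; rewrite // finset.setUC.
apply/implyP => uD; have /set0Pn[e] := dom u uD.
rewrite inE => /andP[/imsetP[v vD ->] uvE].
apply/existsP; exists v; rewrite vD /adj finset.setUC uvE andbT.
by apply: contraNneq uD => <-.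
Qed.

Lemma dominatingS E D D' : D \subset D' -> dominating E D -> dominating E D'.
Proof.
move=> DD' /dominatingP dom; apply/dominatingP => u uD'.
have /set0Pn[e] := dom u (contra (fintype.subsetP DD' u) uD').
rewrite inE => /andP[eu eE]; apply/set0Pn; exists e.
by rewrite inE eE (fintype.subsetP (starS u DD')).
Qed.

Lemma dominatingSE E E' D : E \subset E' -> dominating E D -> dominating E' D.
Proof.
move=> EE' /dominatingP dom; apply/dominatingP => u uD.
have /set0Pn[e] := dom u uD; rewrite inE => /andP[eu eE].
by apply/set0Pn; exists e; rewrite inE eu (fintype.subsetP EE').
Qed.

Lemma dominatingT E : dominating E [set: T]%SET.
Proof. by apply/dominatingP => u; rewrite inE. Qed.

Lemma domination_number_ex E :
  exists2 D : {set T}, dominating E D & #|D| = domination_number E.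
Proof.
rewrite /domination_number; case: arg_minnP; first exact: dominatingT.
by move=> D dom _; exists D.
Qed.

Lemma domination_number_le E D : dominating E D -> (domination_number E <= #|D|)%N.
Proof.
move=> dom; rewrite /domination_number.
by case: arg_minnP => [|D' _]; [exact: dominatingT|apply].
Qed.

Lemma domination_numberS E E' :
  E \subset E' -> (domination_number E' <= domination_number E)%N.
Proof.
move=> EE'; have [D dom <-] := domination_number_ex E.
exact/domination_number_le/(dominatingSE EE').
Qed.

Lemma bondage_number_le E B : B \subset E ->
    (domination_number E < domination_number (E :\: B))%N ->
  (bondage_number E <= #|B|)%N.
Proof.
move=> BE gB; rewrite /bondage_number; case: arg_minnP => [|B' _].
  rewrite fintype.subxx finset.setDv /=; apply: leq_trans gB _.
  by apply: domination_numberS; apply: finset.sub0set.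
by apply; rewrite BE.
Qed.

Lemma bondage_number_ex E B : B \subset E ->
    (domination_number E < domination_number (E :\: B))%N ->
  exists2 B' : {set {set T}}, (domination_number E < domination_number (E :\: B'))%N &
              #|B'| = bondage_number E.
Proof.
move=> BE gB; rewrite /bondage_number; case: arg_minnP => [|B'].
  rewrite fintype.subxx finset.setDv /=; apply: leq_trans gB _.
  by apply: domination_numberS; apply: finset.sub0set.
by case/andP => _ ? _; exists B'.
Qed.

Definition nbrs E u : {set T} := [set v | adj E u v]%SET.

Definition edges_at E u : {set {set T}} := [set [set u; v]%SET | v in nbrs E u].

Lemma card_edges_at E u : #|edges_at E u| = #|nbrs E u|.
Proof. by rewrite card_in_imset // => v v' _ _; apply: set2_inj. Qed.

Lemma adjC E u v : adj E u v = adj E v u.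
Proof. by rewrite /adj eq_sym finset.setUC. Qed.

(* Isolating both ends of an edge [uv] forces [u] and [v] into every dominating
   set, whereas in the original graph [v] dominates [u]. *)
Lemma bondage_witness E u v : adj E u v ->
  exists2 B : {set {set T}}, B \subset E & (domination_number E < domination_number (E :\: B))%N
    /\ (#|B| <= #|nbrs E u| + #|nbrs E v|)%N.
Proof.
move=> uv; pose B := edges_at E u :|: edges_at E v.
have sub w : edges_at E w \subset E.
  by apply/fintype.subsetP => e /imsetP[x]; rewrite inE => /andP[_ xE] ->.
exists B; first by rewrite finset.subUset !sub.
split; last by rewrite -!card_edges_at cardsU leq_subr.
have [D dom <-] := domination_number_ex (E :\: B).
have inD w : edges_at E w \subset B -> w \in D.
  move=> wB; apply: contraT => wD.
  move/dominatingP: (dom) => /(_ w wD)/set0Pn[e]; rewrite !inE.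
  case/andP => /imsetP[x xD ->] /andP[/negP nB xE]; case: nB.
  have /fintype.subsetP/(_ [set w; x]%SET) := wB; rewrite inE; apply.
  apply/imsetP; exists x; rewrite // inE /adj xE andbT.
  by apply: contraNneq wD => ->.
have uD : u \in D by apply: inD; rewrite finset.subsetUl.
have vD : v \in D by apply: inD; rewrite finset.subsetUr.
rewrite (cardsD1 u D) uD add1n ltnS; apply: domination_number_le.
apply/dominatingP => w; rewrite !inE negb_and negbK.
have [-> _|wu /= wD] := eqVneq w u.
  case/andP: uv => uv uvE; apply/set0Pn; exists [set u; v]%SET.
  rewrite inE uvE andbT; apply/imsetP; exists v => //.
  by rewrite !inE vD eq_sym uv.
move/dominatingP: (dom) => /(_ w wD)/set0Pn[e]; rewrite !inE negb_or.
case/andP => /imsetP[x xD ->] /andP[/andP[nu _] xE].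
apply/set0Pn; exists [set w; x]%SET; rewrite inE xE andbT.
apply/imsetP; exists x => //; rewrite !inE xD andbT.
apply: contraNneq nu => xu; apply/imsetP; exists w; rewrite -?xu.
  rewrite inE /adj finset.setUC xE andbT.
  by apply: contraNneq wD => <-.
by rewrite finset.setUC.
Qed.

Lemma max_degree_ge E u : (#|nbrs E u| <= max_degree E)%N.
Proof.
have -> : nbrs E u = [set v | adj E v u]%SET.
  by apply/setP => v; rewrite !inE adjC.
exact: (leq_bigmax_cond (F := fun u => #|[set v | adj E v u]%SET|)).
Qed.

Lemma edge_adj E e : E \subset all_edges T -> e \in E ->
  exists u v, adj E u v /\ e = [set u; v]%SET.
Proof.
move=> /fintype.subsetP sE eE; have := sE e eE.
rewrite inE => /cards2P[u [v [uv ee]]]; exists u, v.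
by rewrite /adj uv -ee eE.
Qed.

Lemma bondage_le_max_degree E :
    E \subset all_edges T -> E != finset.set0 ->
  (bondage_number E <= 2 * max_degree E)%N.
Proof.
move=> sE /set0Pn[e eE]; have [u [v [uv _]]] := edge_adj sE eE.
have [B BE [gB cB]] := bondage_witness uv.
apply: leq_trans (bondage_number_le BE gB) (leq_trans cB _).
by rewrite mul2n -addnn leq_add ?max_degree_ge.
Qed.

(** An edge supplies an admissible deletion set through [bondage_witness], so the minimum defining
    [bondage_number] is attained and is not the default value. *)
Lemma bondage_lb E (k b : nat) :
    E \subset all_edges T -> E != finset.set0 -> domination_number E = k ->
    (forall B, (#|B| <= b)%N ->
       exists2 D : {set T}, #|D| = k & dominating (E :\: B) D) ->
  (b < bondage_number E)%N.
Proof.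
move=> sE /set0Pn[e eE] gE rob; have [u [v [uv _]]] := edge_adj sE eE.
have [B BE [gB _]] := bondage_witness uv.
have [B' gB' <-] := bondage_number_ex BE gB.
rewrite ltnNge; apply/negP => /rob[D Dk dom].
by move: gB'; rewrite gE ltnNge -Dk domination_number_le.
Qed.

(** Deleted edges are oriented: the first vertex is the one that may lose its neighbours, the second
    lies in the dominating set. *)
Definition pairs B : {set T * T} :=
  [set x : T * T | (x.1 != x.2) && ([set x.1; x.2]%SET \in B)]%SET.

Lemma card_pairs B : (#|pairs B| <= 2 * #|B|)%N.
Proof.
pose h (x : T * T) := [set x.1; x.2]%SET.
rewrite -sum1_card (partition_big h (mem B)); last first.
  by move=> x; rewrite inE => /andP[].
rewrite mulnC -sum_nat_const; apply: leq_sum => e eB; rewrite sum1dep_card.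
have [->|[x0 x0e]] := finset.set_0Vmem
  [set x : T * T | (x \in pairs B) && (h x == e)]%SET.
  by rewrite cards0.
apply: (@leq_trans #|[set x0; (x0.2, x0.1)]%SET|); last first.
  by rewrite cards2; case: (_ != _).
apply: subset_leq_card; apply/fintype.subsetP => x.
move: x0e; rewrite !inE => /andP[_ /eqP<-] /andP[_ /eqP].
case: x x0 => u v [u0 v0] /=; rewrite /h /= => /setP2[] [-> ->];
  by rewrite eqxx ?orbT.
Qed.

Lemma card_edges_le_max_degree E : E \subset all_edges T ->
  (#|E| <= #|T| * max_degree E)%N.
Proof.
move=> sE.
have sub : E \subset \bigcup_(u : T) edges_at E u.
  apply/fintype.subsetP => e eE; have [u [v [uv ->]]] := edge_adj sE eE.
  by apply/bigcupP; exists u => //; apply/imsetP; exists v; rewrite ?inE.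
apply: leq_trans (subset_leq_card sub) _.
have le (s : seq T) :
    (#|\bigcup_(u <- s) edges_at E u| <= size s * max_degree E)%N.
  elim: s => [|u s IH]; first by rewrite big_nil cards0.
  rewrite big_cons /= mulSn (leq_trans _ (leq_add (max_degree_ge E u) IH)) //.
  by rewrite -card_edges_at cardsU leq_subr.
by rewrite cardT -[index_enum T]enumT in le *; rewrite (leq_trans (le _)) // enumT.
Qed.

End GraphFacts.

(** * Survival of dominating sets under edge deletion *)

Section Robustness.
Variables (R : realType) (T : finType).
Implicit Types (E B : {set {set T}}) (D S : {set T}) (u v : T) (k s : nat).

Definition dom E D : R := (dominating E D)%:R.

Definition dom_count k E : R := \sum_(D : {set T} | #|D| == k) dom E D.

Definition dom_through k E v : R :=
  \sum_(D : {set T} | #|D| == k) (v \in D)%:R * dom E D.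

Definition frail s E u D : bool := (u \notin D) && (#|star u D :&: E| <= s)%N.

Definition frail_through k s E u v : R :=
  \sum_(D : {set T} | #|D| == k) ((v \in D) && frail s E u D)%:R * dom E D.

Lemma sum_dom_through k E : \sum_v dom_through k E v = k%:R * dom_count k E.
Proof.
rewrite exchange_big /= /dom_count mulr_sumr.
apply: eq_bigr => D /eqP Dk.
rewrite -big_distrl /= -Dk; congr (_ * _).
by rewrite -sumr_const [RHS]big_mkcond /=; apply: eq_bigr => v _; case: ifP.
Qed.

(** Some [u] outside [D] has lost all its edges to [D], and each sum accounts for one case. If [D]
    contains a heavy vertex, the first sum is at least 1. Otherwise, if [u] had at most [s]
    neighbours in [D], it had at least one since [D] dominated, and that pair counts 1 in the second
    sum. If it had more, at least [s + 1] pairs of the third sum count [1 / (s + 1)] each. *)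
Lemma undominated_count k s E B D (heavy : pred T) :
    #|D| = k -> dominating E D -> ~~ dominating (E :\: B) D ->
  1 <= \sum_(v | heavy v) (v \in D)%:R
     + \sum_(x in pairs B) ((x.2 \in D) && frail s E x.1 D)%:R
     + \sum_(x in pairs B | ~~ heavy x.2) (x.2 \in D)%:R / s.+1%:R :> R.
Proof.
move=> Dk /dominatingP domE ndom.
have [u uD uB] : exists2 u, u \notin D & star u D :&: E \subset B.
  move: ndom => /dominatingP; apply: contra_notP => nu u uD.
  apply/eqP => e0; apply: nu; exists u => //.
  apply/fintype.subsetP => e; rewrite inE => /andP[eu eE].
  apply: contraT => eB; move/setP/(_ e): e0.
  by rewrite !inE eu eE eB.
have s1 : 0 <= \sum_(v | heavy v) (v \in D)%:R :> R by apply: sumr_ge0.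
have s2 : 0 <= \sum_(x in pairs B) ((x.2 \in D) && frail s E x.1 D)%:R :> R.
  exact: sumr_ge0.
have s3 : 0 <= \sum_(x in pairs B | ~~ heavy x.2) (x.2 \in D)%:R / s.+1%:R :> R.
  by apply: sumr_ge0 => x _; rewrite divr_ge0.
pose N := [set v in D | [set u; v]%SET \in E]%SET.
have starN : star u D :&: E = star u N.
  apply/setP => e; rewrite inE; apply/andP/imsetP.
    by case=> /imsetP[v vD ->] uvE; exists v; rewrite // inE vD.
  by case=> v; rewrite inE => /andP[vD uvE] ->; split=> //; apply/imsetP; exists v.
have cN : #|star u D :&: E| = #|N| by rewrite starN card_star.
have NB v : v \in N -> [/\ v \in D & (u, v) \in pairs B].
  move=> vN; move: (vN); rewrite inE => /andP[vD uvE]; split => //.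
  rewrite inE /= (_ : u != v) /=; last by apply: contraNneq uD => ->.
  by apply: (fintype.subsetP uB); rewrite starN; apply/imsetP; exists v.
have [/exists_inP[v vD hv]|nheavy] := boolP [exists v in D, heavy v].
  suff : 1 <= \sum_(v | heavy v) (v \in D)%:R :> R by lra.
  by rewrite (bigD1 v) //= vD lerDl sumr_ge0.
have [sN|sN] := leqP #|N| s.
  have /set0Pn[e] := domE u uD; rewrite starN => /imsetP[v vN _].
  have [vD uvB] := NB v vN.
  suff : 1 <= \sum_(x in pairs B) ((x.2 \in D) && frail s E x.1 D)%:R :> R.
    lra.
  by rewrite (bigD1 (u, v)) //= vD /frail uD cN sN /= lerDl sumr_ge0.
suff : 1 <= \sum_(x in pairs B | ~~ heavy x.2) (x.2 \in D)%:R / s.+1%:R :> R.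
  lra.
apply: (@le_trans _ _ (\sum_(v in N) s.+1%:R^-1)).
  rewrite sumr_const -[leRHS]mulr_natl ler_pdivlMr ?ltr0n //.
  by rewrite mul1r ler_nat.
pose h v := (u, v).
have hI : {in N &, injective h} by move=> x y _ _ [].
rewrite -(big_imset (h := h) (fun=> s.+1%:R^-1)) //=.
rewrite [leRHS]big_mkcond [leLHS]big_mkcond /=; apply: ler_sum => x _.
case: (boolP (x \in _)) => [/imsetP[v vN ->]|_]; last first.
  by case: ifP => // _; rewrite divr_ge0.
have [vD uvB] := NB v vN; rewrite uvB /= vD mul1r.
suff -> : ~~ heavy v by [].
by apply: contraNN nheavy => hv; apply/exists_inP; exists v.
Qed.

Lemma robust_count k s E B (heavy : pred T) :
    (forall D, #|D| = k -> ~~ dominating (E :\: B) D) ->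
  dom_count k E <= \sum_(v | heavy v) dom_through k E v
     + \sum_(x in pairs B) frail_through k s E x.1 x.2
     + \sum_(x in pairs B | ~~ heavy x.2) dom_through k E x.2 / s.+1%:R.
Proof.
move=> nd.
apply: (@le_trans _ _ (\sum_(D : {set T} | #|D| == k)
   (\sum_(v | heavy v) (v \in D)%:R
     + \sum_(x in pairs B) ((x.2 \in D) && frail s E x.1 D)%:R
     + \sum_(x in pairs B | ~~ heavy x.2) (x.2 \in D)%:R / s.+1%:R) * dom E D)).
  apply: ler_sum => D /eqP Dk; rewrite /dom.
  case: (boolP (dominating E D)) => dD; last by rewrite mulr0.
  by rewrite mulr1; apply: undominated_count => //; apply: nd.
rewrite le_eqVlt; apply/orP; left; apply/eqP.
under eq_bigr do rewrite !mulrDl !mulr_suml.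
rewrite !big_split /=; congr (_ + _ + _); rewrite exchange_big //=.
apply: eq_bigr => x _; rewrite mulr_suml; apply: eq_bigr => D _.
by rewrite mulrAC.
Qed.

(* If [z] is the typical number of dominating [k]-sets through a vertex, then
   the dominating sets through a vertex carrying more than [2 z] of them are few
   and can be discarded; every other one dies either at a vertex having at most
   [s] neighbours in it, or by losing more than [s] edges at once. *)
Lemma robust_dominating k s E B (mu L : R) :
    (0 < k)%N -> (0 < #|T|)%N -> 0 < mu -> 0 < L ->
    \sum_v (dom_through k E v - k%:R * mu / #|T|%:R) ^+ 2 <=
      k%:R / #|T|%:R * mu ^+ 2 / 100%:R ->
    L * (\sum_u \sum_v frail_through k s E u v ^+ 2) <= mu ^+ 2 / 100%:R ->
    #|B|%:R <= L -> 16%:R * L * k%:R / #|T|%:R <= s.+1%:R ->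
  exists2 D : {set T}, #|D| = k & dominating (E :\: B) D.
Proof.
move=> k0 T0 mu0 L0 HQ HW BL Ls.
have [[D Dk domD]|nex] := pselect (exists2 D : {set T}, #|D| = k & dominating (E :\: B) D).
  by exists D.
exfalso.
have nd D : #|D| = k -> ~~ dominating (E :\: B) D.
  by move=> Dk; apply/negP => dD; apply: nex; exists D.
set n : R := #|T|%:R in HQ Ls *; set kr : R := k%:R in HQ Ls *.
have n0 : 0 < n by rewrite ltr0n.
have kr1 : 1 <= kr by rewrite ler1n.
have kr0 : 0 < kr by rewrite ltr0n.
set z := kr * mu / n in HQ *; set Q := \sum_v _ in HQ.
set W := \sum_u _ in HW.
have z0 : 0 < z by rewrite !divr_gt0 ?mulr_gt0.
have Q0 : 0 <= Q by apply: sumr_ge0 => v _; apply: sqr_ge0.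
have W0 : 0 <= W.
  by apply: sumr_ge0 => u _; apply: sumr_ge0 => v _; apply: sqr_ge0.
have Qz : Q / z <= mu / 100%:R.
  rewrite ler_pdivrMr // (le_trans HQ) // le_eqVlt; apply/orP; left; apply/eqP.
  by rewrite /z; field; apply: lt0r_neq0.
have Xlb : 79%:R / 100%:R * mu <= dom_count k E.
  (* A concave parabola below the identity turns the bound on squared deviations into a lower bound
     on the count: after summation, 7/8 - 8/100 exceeds 79/100. *)
  have lb v : z * (7%:R / 8%:R) - 8%:R / z * (dom_through k E v - z) ^+ 2 <= dom_through k E v.
    rewrite -subr_ge0.
    have -> : dom_through k E v - (z * (7%:R / 8%:R) - 8%:R / z * (dom_through k E v - z) ^+ 2)
       = 8%:R / z * ((dom_through k E v - z + z / 16%:R) ^+ 2 + 3%:R / 256%:R * z ^+ 2).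
      by field; apply: lt0r_neq0.
    have := sqr_ge0 (dom_through k E v - z + z / 16%:R); have := sqr_ge0 z.
    move=> ? ?; apply: mulr_ge0; last lra.
    by apply: divr_ge0 => //; apply: ltW.
  have : \sum_v (z * (7%:R / 8%:R) - 8%:R / z * (dom_through k E v - z) ^+ 2) <=
         \sum_v dom_through k E v by apply: ler_sum.
  rewrite sum_dom_through sumrB sumr_const -[X in X - _]mulr_natr -mulr_sumr -/Q -/n -/kr.
  have -> : z * (7%:R / 8%:R) * n = kr * (mu * (7%:R / 8%:R)).
    by rewrite /z; field; apply: lt0r_neq0.
  have -> : 8%:R / z * Q = 8%:R * (Q / z) by ring.
  move=> h; rewrite -(ler_pM2l kr0); nra.
pose heavy := [pred v | 2 * z < dom_through k E v].
(* If [Z > 2 z] then [Z - z] exceeds both [z] and [Z / 2], hence [Z <= 2 (Z - z) ^ 2 / z]. *)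
have heavyb : \sum_(v | heavy v) dom_through k E v <= 2 * (Q / z).
  rewrite mulr_suml mulr_sumr big_mkcond /=; apply: ler_sum => v _.
  have sq : 0 <= (dom_through k E v - z) ^+ 2 / z by rewrite divr_ge0 ?sqr_ge0 ?ltW.
  case: ifP => hv; last by rewrite mulr_ge0.
  by rewrite mulrA ler_pdivlMr //; nra.
(* Cauchy-Schwarz in the form [y <= t + y ^ 2 / t], with [t] chosen so that the at most [2 L]
   oriented pairs contribute [mu / 8] through the first term. *)
have Yb : \sum_(x in pairs B) frail_through k s E x.1 x.2 <= mu / 8%:R + 16%:R / mu * (L * W).
  pose t := mu / (16%:R * L); have t0 : 0 < t by rewrite divr_gt0 ?mulr_gt0.
  apply: (@le_trans _ _ (\sum_(x in pairs B) (t + frail_through k s E x.1 x.2 ^+ 2 / t))).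
    apply: ler_sum => x _; rewrite -subr_ge0; set y := frail_through _ _ _ _ _.
    have -> : t + y ^+ 2 / t - y = ((y - t / 2) ^+ 2 + 3 / 4 * t ^+ 2) / t.
      by field; apply: lt0r_neq0.
    have := sqr_ge0 (y - t / 2); have := sqr_ge0 t.
    by move=> ? ?; apply: divr_ge0; [lra|apply: ltW].
  rewrite big_split /=; apply: lerD.
    rewrite sumr_const -[leLHS]mulr_natr.
    have : #|pairs B|%:R <= 2 * #|B|%:R :> R by rewrite -natrM ler_nat card_pairs.
    move=> h; apply: (@le_trans _ _ (t * (2 * L))).
      by rewrite ler_pM2l //; lra.
    by rewrite le_eqVlt; apply/orP; left; apply/eqP; rewrite /t; field; apply: lt0r_neq0.
  have -> : 16%:R / mu * (L * W) = W / t.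
    by rewrite /t; field; rewrite !lt0r_neq0.
  rewrite -mulr_suml ler_pM2r ?invr_gt0 // /W.
  rewrite (pair_bigA _ (fun u v => frail_through k s E u v ^+ 2)) /= big_mkcond /=.
  by apply: ler_sum => x _; case: ifP => // _; apply: sqr_ge0.
have Zb : \sum_(x in pairs B | ~~ heavy x.2) dom_through k E x.2 / s.+1%:R <= mu / 4%:R.
  apply: (@le_trans _ _ (\sum_(x in pairs B) (2 * z / s.+1%:R))).
    rewrite big_mkcondr /=; apply: ler_sum => x _.
    case: ifP => [|_]; last by rewrite divr_ge0 // mulr_ge0 // ltW.
    by rewrite -leNgt => hx; rewrite ler_pM2r ?invr_gt0 ?ltr0n.
  rewrite sumr_const -[leLHS]mulr_natr.
  have : #|pairs B|%:R <= 2 * #|B|%:R :> R by rewrite -natrM ler_nat card_pairs.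
  move=> h; apply: (@le_trans _ _ (2 * z / s.+1%:R * (2 * L))).
    apply: ler_wpM2l; last by lra.
    by apply: divr_ge0 => //; apply: mulr_ge0 => //; apply: ltW.
  rewrite mulrAC ler_pdivrMr ?ltr0n //.
  have -> : 2 * z * (2 * L) = mu / 4%:R * (16%:R * L * kr / n).
    by rewrite /z; field; apply: lt0r_neq0.
  by rewrite ler_pM2l // divr_gt0.
(* The three sums are at most 0.02, 0.125 + 0.16 and 0.25 times [mu], together less than the 0.79
   [mu] of [Xlb]. *)
have := robust_count s heavy nd; set S1 := \sum_(v | heavy v) _ in heavyb *.
have : 16%:R / mu * (L * W) <= 16%:R / 100%:R * mu.
  rewrite mulrAC ler_pdivrMr //; nra.
lra.
Qed.

End Robustness.

(** * Dominating sets of the binomial random graph *)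

Section RandomGraph.
Variables (R : realType) (T : finType) (r : R).
Hypothesis r01 : 0 <= r <= 1.
Implicit Types (E B : {set {set T}}) (D S : {set T}) (u v : T) (k s : nat).
Local Notation n := #|T|.

(** Here [r] is the probability of a non-edge. The weight 0 off the pairs makes every family of
    nonzero probability a graph, see [pweight_edges]. *)
Definition gw (e : {set T}) : R := if e \in all_edges T then 1 - r else 0.

Local Notation EG := (Ex gw).

Lemma gw01 e : 0 <= gw e <= 1.
Proof. by rewrite /gw; case: ifP => _; case/andP: r01 => *; apply/andP; split; lra. Qed.

Lemma pweight_edges E : pweight gw E != 0 -> E \subset all_edges T.
Proof.
apply: contraR => /fintype.subsetPn[e eE en].
by rewrite /pweight (bigD1 e) //= eE /gw (negbTE en) mul0r.
Qed.

Lemma EG_gen (c : R) (A : {set {set T}}) : A \subset all_edges T ->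
  EG (fun E => c ^+ #|A :&: E|) = (r + (1 - r) * c) ^+ #|A|.
Proof.
move=> /fintype.subsetP sA; rewrite Ex_gen -prodr_const; apply: eq_bigr => e eA.
by rewrite /gw sA //; ring.
Qed.

(** An indicator, written as a power of 0 so that its expectation is the generating function
    [EG_gen] at 0. *)
Definition undom u D E : R := 0 ^+ #|star u D :&: E|.

Lemma undomE u D E : undom u D E = (star u D :&: E == finset.set0)%:R.
Proof. by rewrite /undom expr0n cards_eq0. Qed.

Lemma domE E D : dom R E D = \prod_(u | u \notin D) (1 - undom u D E).
Proof.
rewrite /dom; case: (boolP (dominating E D)) => [/dominatingP|] d.
  by rewrite big1 // => u uD; rewrite undomE (negbTE (d u uD)) subr0.
have [u uD u0] : exists2 u, u \notin D & star u D :&: E == finset.set0.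
  move: d => /dominatingP; apply: contra_notP => nu u uD.
  by apply/negP => u0; apply: nu; exists u.
by rewrite (bigD1 u) //= undomE u0 subrr mul0r.
Qed.

Lemma EG_undom u D : u \notin D -> EG (undom u D) = r ^+ #|D|.
Proof.
move=> uD; rewrite /undom EG_gen ?star_edges // mulr0 addr0.
by rewrite card_star.
Qed.

Lemma card_notin S : #|[predC S]| = (n - #|S|)%N.
Proof. by rewrite -(cardC S) addKn. Qed.

Lemma starI u S D E : D \subset S ->
  star u D :&: (E :&: star u S) = star u D :&: E.
Proof.
move=> DS; apply/setP => e; rewrite !inE.
case: (boolP (e \in star u D)) => //= eD.
by rewrite (fintype.subsetP (starS u DS)) ?andbT.
Qed.

Lemma EG_dom D : EG (fun E => dom R E D) = (1 - r ^+ #|D|) ^+ (n - #|D|).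
Proof.
rewrite (eq_Ex _ (domE^~ D)).
rewrite (Ex_indep_prod _ (A := fun u => star u D)) //; first last.
- by move=> u E uD; rewrite /undom starI.
- by move=> u v uD vD uv; apply: star_disjoint.
rewrite -card_notin -[RHS]prodr_const; apply: eq_bigr => u uD.
by rewrite ExB ExC EG_undom.
Qed.

Lemma undomU u D D' E : undom u D E * undom u D' E = undom u (D :|: D') E.
Proof.
rewrite !undomE -natrM mulnb; congr (_%:R); congr nat_of_bool.
by rewrite starU finset.setIUl finset.setU_eq0.
Qed.

Definition dom2 D D' u E : R := (1 - undom u D E) * (1 - undom u D' E).

Lemma dom2_01 D D' u E : 0 <= dom2 D D' u E <= 1.
Proof.
rewrite /dom2 !undomE.
by do 2 case: (_ == _); rewrite ?subrr ?subr0 ?mul0r ?mulr0 ?mulr1 ?lexx ?ler01.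
Qed.

(** The conditions at vertices of the union are dropped: they involve edges inside the union,
    whereas the conditions at the remaining vertices are independent. The loss is only of order [k]
    factors. *)
Lemma dom_mul E D D' :
  dom R E D * dom R E D' <= \prod_(u | u \notin D :|: D') dom2 D D' u E.
Proof.
have [dD|nD] := boolP (dominating E D); last first.
  rewrite /dom (negbTE nD) mul0r prodr_ge0 // => u _.
  by case/andP: (dom2_01 D D' u E).
have [dD'|nD'] := boolP (dominating E D'); last first.
  rewrite /dom (negbTE nD') mulr0 prodr_ge0 // => u _.
  by case/andP: (dom2_01 D D' u E).
rewrite /dom dD dD' mulr1 big1 // => u; rewrite inE negb_or => /andP[uD uD'].
rewrite /dom2 !undomE (negbTE (dominatingP _ _ dD u uD)).
by rewrite (negbTE (dominatingP _ _ dD' u uD')) !subr0 mulr1.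
Qed.

Lemma EG_dom2 D D' k u : #|D| = k -> #|D'| = k -> u \notin D :|: D' ->
  EG (dom2 D D' u) = 1 - 2 * r ^+ k + r ^+ #|D :|: D'|.
Proof.
move=> Dk D'k uS; move: (uS); rewrite inE negb_or => /andP[uD uD'].
rewrite (eq_Ex _ (g := fun E =>
  (1 - undom u D E) - (undom u D' E - undom u (D :|: D') E))); last first.
  by move=> E; rewrite /dom2 -undomU; ring.
by rewrite !ExB ExC !EG_undom // Dk D'k; ring.
Qed.

Lemma EG_dom_mul D D' k : #|D| = k -> #|D'| = k ->
  EG (fun E => dom R E D * dom R E D') <=
  (1 - 2 * r ^+ k + r ^+ #|D :|: D'|) ^+ (n - #|D :|: D'|).
Proof.
move=> Dk D'k.
apply: le_trans (le_Ex gw01 (fun E _ => dom_mul E D D')) _.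
rewrite (Ex_indep_prod _ (A := fun u => star u (D :|: D'))) //; first last.
- move=> u E uD; rewrite /dom2 /undom.
  by rewrite !starI ?finset.subsetUl ?finset.subsetUr.
- by move=> u v uD vD uv; apply: star_disjoint.
rewrite -card_notin -[leRHS]prodr_const le_eqVlt; apply/orP; left; apply/eqP.
by apply: eq_bigr => u uD; rewrite (EG_dom2 Dk D'k).
Qed.

(* A vertex having few neighbours in both sets is charged by the exponential
   moment [c ^ #neighbours]. *)
Lemma EG_dom_mul_frail D D' k s (c : R) u0 :
    0 < c <= 1 -> #|D| = k -> #|D'| = k -> u0 \notin D :|: D' ->
  EG (fun E => (frail s E u0 D && frail s E u0 D')%:R * (dom R E D * dom R E D')) <=
  c ^- (2 * s) * ((r + (1 - r) * c) ^+ #|D :|: D'| *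
  (1 - 2 * r ^+ k + r ^+ #|D :|: D'|) ^+ (n - #|D :|: D'| - 1)).
Proof.
move=> /andP[c0 c1] Dk D'k u0S; set S := D :|: D' in u0S *.
pose phi u E : R := if u == u0 then c ^+ #|star u S :&: E| else dom2 D D' u E.
apply: (@le_trans _ _ (EG (fun E => c ^- (2 * s) *
    \prod_(u | u \notin S) phi u E))).
  apply: (le_Ex gw01) => E _; case: (boolP (_ && _)) => [/andP[]|_]; last first.
    rewrite mul0r mulr_ge0 ?invr_ge0 ?exprn_ge0 ?(ltW c0) // prodr_ge0 // => u _.
    rewrite /phi; case: ifP => _; first by rewrite exprn_ge0 ?(ltW c0).
    by case/andP: (dom2_01 D D' u E).
  case/andP => _ b /andP[_ b']; rewrite mul1r.
  apply: le_trans (dom_mul E D D') _.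
  rewrite [leLHS](bigD1 u0) //= [in leRHS](bigD1 u0) //= {1}/phi eqxx mulrA.
  have eqp : \prod_(u | (u \notin S) && (u != u0)) phi u E =
             \prod_(u | (u \notin S) && (u != u0)) dom2 D D' u E.
    by apply: eq_bigr => u /andP[_ /negbTE]; rewrite /phi => ->.
  rewrite eqp; apply: ler_wpM2r.
    by apply: prodr_ge0 => u _; case/andP: (dom2_01 D D' u E).
  apply: (@le_trans _ _ 1); first by case/andP: (dom2_01 D D' u0 E).
  rewrite mulrC ler_pdivlMr ?exprn_gt0 // mul1r ler_wiXn2l ?(ltW c0) //.
  rewrite mul2n -addnn (leq_trans _ (leq_add b b')) //.
  rewrite starU finset.setIUl cardsU leq_subr //.
rewrite ExZ ler_pM2l ?invr_gt0 ?exprn_gt0 //.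
rewrite (Ex_indep_prod _ (A := fun u => star u S)) //; first last.
- move=> u E uD; rewrite /phi; case: ifP => _; first by rewrite starI.
  by rewrite /dom2 /undom !starI ?finset.subsetUl ?finset.subsetUr.
- by move=> u v uD vD uv; apply: star_disjoint.
rewrite (bigD1 u0) //= le_eqVlt; apply/orP; left; apply/eqP; congr (_ * _).
  by rewrite /phi eqxx EG_gen ?star_edges // card_star.
have -> : (n - #|S| - 1)%N = #|[predD1 [predC S] & u0]|.
  by rewrite -card_notin (cardD1 u0 [predC S]) inE /= u0S add1n subn1.
rewrite -[RHS]prodr_const; apply: eq_big => u; first by rewrite !inE andbC.
by case/andP => uS /negbTE uu0; rewrite /phi uu0 (EG_dom2 Dk D'k).
Qed.

Lemma card_overlap S (k i : nat) :
  (#|[set D : {set T} | (#|D| == k) && (#|S :&: D| == i)]%SET| <=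
   'C(#|S|, i) * 'C(n - #|S|, k - i))%N.
Proof.
have <- : #|~: S| = (n - #|S|)%N by rewrite cardsCs finset.setCK.
rewrite -(cards_draws S i) -(cards_draws (~: S) (k - i)%N) -cardsX.
pose h D := (S :&: D, D :\: S).
have hI : injective h.
  by move=> D D' [e1 e2]; rewrite -(finset.setID D S) -(finset.setID D' S) e2 [D :&: S]finset.setIC
    [D' :&: S]finset.setIC e1.
rewrite -(card_imset _ hI); apply: subset_leq_card.
apply/fintype.subsetP => e /imsetP[D]; rewrite inE => /andP[/eqP Dk /eqP Di] ->.
rewrite !inE /= finset.subsetIl Di eqxx finset.setDE finset.subsetIr /=.
rewrite -finset.setDE.
by rewrite -Dk -Di -(cardsID S D) [D :&: S]finset.setIC addKn.
Qed.

Lemma overlap_sum S k (F : nat -> R) : (forall i, 0 <= F i) ->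
  \sum_(D : {set T} | #|D| == k) F #|S :&: D| <=
  \sum_(i < k.+1) ('C(#|S|, i) * 'C(n - #|S|, k - i))%N%:R * F i.
Proof.
move=> F0.
have le D : #|D| == k -> (#|S :&: D| < k.+1)%N.
  by move/eqP => <-; rewrite ltnS subset_leq_card ?finset.subsetIr.
rewrite (partition_big (fun D => inord #|S :&: D| : 'I_k.+1) predT) //=.
apply: ler_sum => i _.
rewrite (eq_bigr (fun=> F i)); last first.
  by move=> D /andP[Dk /eqP <-]; rewrite inordK // le.
rewrite sumr_const -[leLHS]mulr_natl ler_wpM2r // ler_nat.
apply: leq_trans (card_overlap S k i); rewrite subset_leq_card //.
apply/fintype.subsetP => D; rewrite !inE => /andP[Dk /eqP <-].
by rewrite Dk inordK ?le /=.
Qed.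

Lemma sum_ksets_const k (c : R) :
  \sum_(D : {set T} | #|D| == k) c = 'C(n, k)%:R * c.
Proof.
rewrite sumr_const -[LHS]mulr_natl -card_draws; congr (_%:R * _).
by apply: eq_card => D; rewrite [in RHS]inE.
Qed.

(** Each vertex lies in ['C(n - 1, k - 1)] of the sets, which gives mean overlap [k ^ 2 / n]. This
    is the main term that cancels the squared mean in [EG_variance]. *)
Lemma sum_overlap_exact k : (0 < k <= n)%N ->
  \sum_(D : {set T} | #|D| == k) \sum_(D' : {set T} | #|D'| == k)
     #|D :&: D'|%:R <= k%:R ^+ 2 * 'C(n, k)%:R ^+ 2 / n%:R :> R.
Proof.
move=> /andP[k0 kn]; have n0 : (0 < n)%N by apply: leq_trans kn.
have nz : n%:R != 0 :> R by rewrite pnatr_eq0 -lt0n.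
have binE : 'C(n.-1, k.-1)%:R = k%:R * 'C(n, k)%:R / n%:R :> R.
  apply: (mulfI nz); rewrite mulrCA divff // mulr1 -!natrM.
  by rewrite -[in RHS](prednK k0) -{1}(prednK n0) mul_bin_diag prednK // prednK.
have cnt v : \sum_(D' : {set T} | #|D'| == k) (v \in D')%:R <=
             k%:R * 'C(n, k)%:R / n%:R :> R.
  rewrite -binE -natr_sum ler_nat -big_mkcondr sum1dep_card /=.
  have := card_overlap [set v]%SET k 1; rewrite cards1 mul1n !subn1.
  apply: leq_trans; apply: subset_leq_card; apply/fintype.subsetP => D.
  rewrite !inE => /andP[-> vD] /=; rewrite (_ : _ :&: _ = [set v]%SET) ?cards1 //.
  by apply/finset.setIidPl; rewrite finset.sub1set.
apply: (@le_trans _ _ (\sum_(D : {set T} | #|D| == k)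
   (k%:R * (k%:R * 'C(n, k)%:R / n%:R)))).
  apply: ler_sum => D /eqP Dk.
  rewrite (eq_bigr (fun D' => \sum_(v in D) (v \in D')%:R)); last first.
    move=> D' _; rewrite -sumr_const big_mkcond [RHS]big_mkcond /=.
    by apply: eq_bigr => v _; rewrite inE; case: (v \in D); case: (v \in D').
  rewrite exchange_big /= -{2}Dk mulr_natl -sumr_const.
  by apply: ler_sum => v _; apply: cnt.
rewrite sum_ksets_const le_eqVlt; apply/orP; left.
by apply/eqP; ring.
Qed.

Definition expdom k : R := 'C(n, k)%:R * (1 - r ^+ k) ^+ (n - k).

Lemma EG_dom_count k : EG (dom_count R k) = expdom k.
Proof.
rewrite Ex_sum (eq_bigr (fun=> (1 - r ^+ k) ^+ (n - k))); last first.
  by move=> D /eqP Dk; rewrite EG_dom Dk.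
by rewrite sum_ksets_const.
Qed.

(* The hypergeometric probability that a random [k]-set meets a given one in
   [i] elements. *)
Definition ovl (k i : nat) : R := ('C(k, i) * 'C(n - k, k - i))%N%:R / 'C(n, k)%:R.

Lemma sum_pairs_overlap k (F : nat -> R) : (k <= n)%N -> (forall i, 0 <= F i) ->
  \sum_(D : {set T} | #|D| == k) \sum_(D' : {set T} | #|D'| == k)
    F #|D :&: D'| <= 'C(n, k)%:R ^+ 2 * \sum_(i < k.+1) ovl k i * F i.
Proof.
move=> kn F0.
apply: (@le_trans _ _ (\sum_(D : {set T} | #|D| == k)
   \sum_(i < k.+1) ('C(k, i) * 'C(n - k, k - i))%N%:R * F i)).
  by apply: ler_sum => D /eqP Dk; have := overlap_sum D k F0; rewrite Dk.
rewrite sum_ksets_const expr2 -mulrA.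
rewrite ler_pM2l ?ltr0n ?bin_gt0 // mulr_sumr le_eqVlt; apply/orP; left.
apply/eqP/eq_bigr => i _; rewrite /ovl; field.
by rewrite pnatr_eq0 -lt0n bin_gt0.
Qed.

End RandomGraph.

(** * First and second moments over pairs of k-sets *)

Section Moments.
Variables (R : realType) (T : finType) (r : R).
Hypothesis r01 : 0 <= r <= 1.
Implicit Types (E B : {set {set T}}) (D S : {set T}) (u v : T) (k s i : nat).
Local Notation n := #|T|.
Local Notation EG := (Ex (gw (T := T) r)).
Local Notation mu := (expdom T r).
Local Notation ov := (ovl R T).

Lemma card_inter_sum D D' :
  #|D :&: D'|%:R = \sum_v (v \in D)%:R * (v \in D')%:R :> R.
Proof.
rewrite -sum1_card natr_sum big_mkcond /=; apply: eq_bigr => v _.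
by rewrite inE -natrM mulnb; case: (_ && _).
Qed.

Lemma sum_dom_through_sqr k E : \sum_v dom_through R k E v ^+ 2 =
  \sum_(D : {set T} | #|D| == k) \sum_(D' : {set T} | #|D'| == k)
    #|D :&: D'|%:R * (dom R E D * dom R E D').
Proof.
under eq_bigr do rewrite expr2 big_distrlr /=.
rewrite exchange_big /=; apply: eq_bigr => D _.
rewrite exchange_big /=; apply: eq_bigr => D' _.
rewrite card_inter_sum mulr_suml; apply: eq_bigr => v _; ring.
Qed.

Lemma sum_frail_through_sqr k s E u : \sum_v frail_through R k s E u v ^+ 2 =
  \sum_(D : {set T} | #|D| == k) \sum_(D' : {set T} | #|D'| == k)
    #|D :&: D'|%:R * ((frail s E u D && frail s E u D')%:R *
      (dom R E D * dom R E D')).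
Proof.
under eq_bigr do rewrite expr2 big_distrlr /=.
rewrite exchange_big /=; apply: eq_bigr => D _.
rewrite exchange_big /=; apply: eq_bigr => D' _.
rewrite card_inter_sum mulr_suml; apply: eq_bigr => v _.
rewrite -!mulnb !natrM; ring.
Qed.

Lemma card_union D D' k : #|D| = k -> #|D'| = k ->
  #|D :|: D'| = (2 * k - #|D :&: D'|)%N.
Proof. by move=> Dk D'k; rewrite cardsU Dk D'k mul2n addnn. Qed.

Lemma inter_le D D' k : #|D| = k -> (#|D :&: D'| <= k)%N.
Proof. by move=> <-; rewrite subset_leq_card ?finset.subsetIl. Qed.

Lemma sum_pairs_expdom k (F : nat -> R) : (k <= n)%N -> (forall i, 0 <= F i) ->
  ((1 - r ^+ k) ^+ (n - k)) ^+ 2 *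
    (\sum_(D : {set T} | #|D| == k) \sum_(D' : {set T} | #|D'| == k)
      F #|D :&: D'|) <=
  mu k ^+ 2 * \sum_(i < k.+1) ov k i * F i.
Proof.
move=> kn F0; rewrite /expdom exprMn -[leRHS]mulrA mulrCA.
by apply: ler_wpM2l; [exact: sqr_ge0|exact: sum_pairs_overlap].
Qed.

(** Expanding the square leaves the second moment minus [k ^ 2 mu ^ 2 / n]. Independent domination
    of the two sets ([rho = 1]) would produce no more than that subtracted term, so only the excess
    [rho i - 1], weighted by the overlap [i], remains. *)
Lemma EG_variance k (rho : nat -> R) : (0 < k <= n)%N ->
    (forall i, 1 <= rho i) ->
    (forall i, (i <= k)%N ->
      (1 - 2 * r ^+ k + r ^+ (2 * k - i)) ^+ (n - (2 * k - i)) <=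
      rho i * ((1 - r ^+ k) ^+ (n - k)) ^+ 2) ->
  EG (fun E => \sum_v (dom_through R k E v - k%:R * mu k / n%:R) ^+ 2) <=
  mu k ^+ 2 * \sum_(i < k.+1) ov k i * (i%:R * (rho i - 1)).
Proof.
move=> k0n rho1 Hrho; have /andP[k0 kn] := k0n.
have n0 : (0 < n)%N by apply: leq_trans kn.
have nz : n%:R != 0 :> R by rewrite pnatr_eq0 -lt0n.
set z := k%:R * mu k / n%:R; set P := (1 - r ^+ k) ^+ (n - k) in Hrho *.
have -> : EG (fun E => \sum_v (dom_through R k E v - z) ^+ 2) =
  EG (fun E => \sum_v dom_through R k E v ^+ 2) - k%:R ^+ 2 * mu k ^+ 2 / n%:R.
  rewrite (eq_Ex _ (g := fun E => \sum_v dom_through R k E v ^+ 2 -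
      (2 * z * k%:R * dom_count R k E - n%:R * z ^+ 2))); last first.
    move=> E; rewrite -[2 * z * _ * _]mulrA -sum_dom_through mulr_sumr.
    have -> : n%:R * z ^+ 2 = \sum_(v : T) z ^+ 2.
      by rewrite sumr_const -[RHS]mulr_natl.
    by rewrite -!sumrB; apply: eq_bigr => v _; ring.
  rewrite !ExB ExC ExZ EG_dom_count //; congr (_ - _).
  by rewrite /z; field.
pose F i : R := i%:R * (rho i - 1).
have F0 i : 0 <= F i by rewrite mulr_ge0 // subr_ge0.
apply: (@le_trans _ _ (P ^+ 2 *
   \sum_(D : {set T} | #|D| == k) \sum_(D' : {set T} | #|D'| == k)
     F #|D :&: D'|)); last first.
  exact: sum_pairs_expdom.
rewrite lerBlDr.
have := ler_wpM2l (sqr_ge0 P) (sum_overlap_exact R k0n).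
have -> : P ^+ 2 * (k%:R ^+ 2 * 'C(n, k)%:R ^+ 2 / n%:R) =
  k%:R ^+ 2 * mu k ^+ 2 / n%:R by rewrite /expdom -/P; ring.
move=> h; apply: le_trans (lerD (lexx _) h); rewrite -mulrDr -big_split /=.
rewrite (eq_Ex _ (sum_dom_through_sqr k)) Ex_sum mulr_sumr; apply: ler_sum => D /eqP Dk.
rewrite Ex_sum -big_split mulr_sumr; apply: ler_sum => D' /eqP D'k /=.
rewrite ExZ.
have -> : P ^+ 2 * (F #|D :&: D'| + #|D :&: D'|%:R) =
  #|D :&: D'|%:R * (rho #|D :&: D'| * P ^+ 2) by rewrite /F; ring.
apply: ler_wpM2l => //; apply: le_trans (EG_dom_mul r01 Dk D'k) _.
by rewrite (card_union Dk D'k) Hrho // (inter_le _ Dk).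
Qed.

Lemma EG_lowdeg k s (c : R) (beta : nat -> R) : (k <= n)%N -> 0 < c <= 1 ->
    (forall i, 0 <= beta i) ->
    (forall i, (i <= k)%N ->
      c ^- (2 * s) * ((r + (1 - r) * c) ^+ (2 * k - i) *
        (1 - 2 * r ^+ k + r ^+ (2 * k - i)) ^+ (n - (2 * k - i) - 1)) <=
      beta i * ((1 - r ^+ k) ^+ (n - k)) ^+ 2) ->
  EG (fun E => \sum_u \sum_v frail_through R k s E u v ^+ 2) <=
  mu k ^+ 2 * \sum_(i < k.+1) ov k i * (i%:R * (n%:R * beta i)).
Proof.
move=> kn c01 b0 Hb; set P := (1 - r ^+ k) ^+ (n - k) in Hb *.
pose F i : R := i%:R * (n%:R * beta i).
have F0 i : 0 <= F i by rewrite !mulr_ge0.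
apply: (@le_trans _ _ (P ^+ 2 *
   \sum_(D : {set T} | #|D| == k) \sum_(D' : {set T} | #|D'| == k)
     F #|D :&: D'|)); last first.
  exact: sum_pairs_expdom.
rewrite Ex_sum; under eq_bigr do rewrite (eq_Ex _ (fun E => sum_frail_through_sqr k s E _)).
under eq_bigr do rewrite Ex_sum.
rewrite exchange_big mulr_sumr /=; apply: ler_sum => D /eqP Dk.
under eq_bigr do rewrite Ex_sum.
rewrite exchange_big mulr_sumr /=; apply: ler_sum => D' /eqP D'k.
have -> : P ^+ 2 * F #|D :&: D'| =
  \sum_(u : T) #|D :&: D'|%:R * (beta #|D :&: D'| * P ^+ 2).
  by rewrite sumr_const -[RHS]mulr_natl /F; ring.
apply: ler_sum => u _; rewrite ExZ; apply: ler_wpM2l => //.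
(* Frailty puts [u] outside the set, so a vertex of the union contributes nothing. *)
have [uS|uS] := boolP (u \in D :|: D').
  rewrite (eq_Ex _ (g := fun=> 0)) ?ExC.
    by apply: mulr_ge0 => //; apply: sqr_ge0.
  move=> E; rewrite /frail; move: uS; rewrite inE.
  by case: (u \in D); case: (u \in D'); rewrite //= ?andbF mul0r.
apply: le_trans (EG_dom_mul_frail r01 s c01 Dk D'k uS) _.
by rewrite (card_union Dk D'k) Hb // (inter_le _ Dk).
Qed.

Lemma nbrs_star E u : #|nbrs E u| = #|star u [set~ u]%SET :&: E|.
Proof.
rewrite -card_edges_at; congr #|pred_of_set _|; apply/setP => e; rewrite inE.
apply/imsetP/andP => [[v]|[/imsetP[v vu ->] uvE]].
  rewrite inE => /andP[uv uvE] ->; split=> //; apply/imsetP; exists v => //.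
  by rewrite !inE eq_sym.
by exists v => //; rewrite !inE in vu *; rewrite /adj uvE eq_sym vu.
Qed.

Lemma EG_degree (c : R) u :
  EG (fun E => c ^+ #|nbrs E u|) = (r + (1 - r) * c) ^+ n.-1.
Proof.
rewrite (eq_Ex _ (g := fun E => c ^+ #|star u [set~ u]%SET :&: E|)); last first.
  by move=> E; rewrite nbrs_star.
by rewrite EG_gen ?star_edges ?card_star ?cardsC1 // !inE eqxx.
Qed.

Lemma EG_size (c : R) :
  EG (fun E => c ^+ #|all_edges T :&: E|) = (r + (1 - r) * c) ^+ 'C(n, 2).
Proof. by rewrite EG_gen // card_draws. Qed.

End Moments.

(** * Transfer from the binomial to the uniform model *)

Section Averaging.
Variables (R : realType) (n : nat) (r : R).
Hypothesis r01 : 0 <= r <= 1.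
Local Notation T := 'I_n.

Lemma pweight_Gnm m (E : {set {set T}}) : E \in Gnm n m ->
  pweight (gw (T := T) r) E = (1 - r) ^+ m * r ^+ #|all_edges T :\: E|.
Proof.
rewrite inE => /andP[sE /eqP <-].
rewrite /pweight (bigID (mem E)) /=; congr (_ * _).
  rewrite -prodr_const; apply: eq_bigr => e eE.
  by rewrite eE /gw (fintype.subsetP sE e eE).
rewrite -prodr_const [RHS]big_mkcond [LHS]big_mkcond /=.
apply: eq_bigr => e _; rewrite inE /gw.
by case: (e \in E) => //=; case: (e \in _); rewrite ?subKr ?subr0.
Qed.

(* The binomial model is a mixture of the uniform ones, so some [m] does at
   least as well as the average. *)
Lemma Gnm_prob_ge (A : pred {set {set T}}) :
  exists m, Ex (gw (T := T) r) (fun E => (A E)%:R) <= Gnm_prob R m A.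
Proof.
pose P (m : 'I_#|{set T}|.+1) := Gnm_prob R m A.
have P_max m : P m <= P [arg max_(i > ord0) P i]%O.
  by case: arg_maxP => // i _; apply.
exists [arg max_(i > ord0) P i]%O; set M := [arg max_(i > ord0) P i]%O in P_max *.
have M0 : 0 <= P M by rewrite divr_ge0.
have split_size (f : {set {set T}} -> R) :
    Ex (gw (T := T) r) f = \sum_(m < #|{set T}|.+1)
      \sum_(E in Gnm n m) pweight (gw r) E * f E.
  rewrite /Ex (bigID (fun E : {set {set T}} => E \subset all_edges T)) /= [X in _ + X]big1 ?addr0.
    rewrite (partition_big (fun E : {set {set T}} => inord #|E| : 'I_#|{set T}|.+1) predT) //=.
    apply: eq_bigr => m _; apply: eq_bigl => E; rewrite inE; congr (_ && _).
    by rewrite -val_eqE /= inordK // ltnS max_card.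
  move=> E; apply: contraNeq => nz; apply: (pweight_edges (r := r)).
  by apply: contraNneq nz => ->; rewrite mul0r.
rewrite -[leRHS]mulr1 -[X in _ * X](Ex1 (gw (T := T) r)) !split_size mulr_sumr.
apply: ler_sum => m _; rewrite -/(P M).
have [->|[E0 E0m]] := finset.set_0Vmem (Gnm n m).
  by rewrite !big_set0 mulr0.
have := P_max m; rewrite /P /Gnm_prob -/(P M) ler_pdivrMr; last first.
  by rewrite ltr0n; apply/card_gt0P; exists E0.
move=> h; pose w := (1 - r) ^+ m * r ^+ ('C(n, 2) - m).
have wE E : E \in Gnm n m -> pweight (gw (T := T) r) E = w.
  move=> Em; rewrite (pweight_Gnm Em) /w; congr (_ * _ ^+ _).
  move: Em; rewrite inE => /andP[sE /eqP <-].
  rewrite cardsD (finset.setIidPr sE) card_draws. congr ('C(_, _) - _)%N; exact: card_ord.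
have w0 : 0 <= w by rewrite -(wE _ E0m); apply: pweight_ge0; apply: gw01.
rewrite (eq_bigr (fun E => w * (A E)%:R)); last by move=> E Em; rewrite wE.
rewrite [X in _ <= _ * X](eq_bigr (fun=> w)); last first.
  by move=> E Em; rewrite wE // mulr1.
rewrite -mulr_sumr sumr_const -[w *+ _]mulr_natr mulrCA ler_wpM2l //.
apply: le_trans h; rewrite -natr_sum ler_nat -big_mkcondr sum1dep_card.
by rewrite leq_eqVlt; apply/orP; left; apply/eqP; apply: eq_card => E; rewrite !inE.
Qed.

End Averaging.

(** * The event of the theorem *)

Section GoodEvent.
Variable R : realType.

Lemma nbrsC (T : finType) (E : {set {set T}}) u :
  nbrs E u = [set v | adj E v u]%SET.
Proof. by apply/setP => v; rewrite !inE adjC. Qed.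

Lemma max_degree_le (T : finType) (E : {set {set T}}) (M : R) :
  0 <= M -> (forall u, #|nbrs E u|%:R <= M) -> (max_degree E)%:R <= M.
Proof.
move=> M0 HM; rewrite /max_degree; apply: (big_ind (fun m => m%:R <= M)) => //.
  by move=> x y Hx Hy; rewrite /maxn; case: ifP.
by move=> u _; rewrite -nbrsC.
Qed.

(** The number of edges is read off the graph instead of being a parameter [m], so that the event is
    fixed before [m] is chosen by averaging. *)
Definition good n k (c1 C1 c2 C2 : R) (E : {set {set 'I_n}}) : bool :=
  let b : R := (bondage_number E)%:R in
  let Delta : R := (max_degree E)%:R in
  let mn : R := #|E|%:R / n%:R in
  [&& domination_number E == k,
      c1 * Delta <= b <= C1 * Delta & c2 * mn <= Delta <= C2 * mn].

Variables (n k s : nat) (p L c1 : R).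
Hypotheses (k0 : (0 < k <= n)%N) (n1 : (1 < n)%N) (p01 : 0 < p <= 1) (L0 : 0 < L).
Hypotheses (c10 : 0 < c1) (Hs : 16%:R * L * k%:R / n%:R <= s.+1%:R).
Hypothesis HL : c1 * (4%:R * p * n%:R) <= L.

Lemma good_event (E : {set {set 'I_n}}) (mu : R) :
    E \subset all_edges 'I_n -> 0 < mu -> dom_count R k.-1 E < 1 ->
    \sum_v (dom_through R k E v - k%:R * mu / n%:R) ^+ 2 <=
      k%:R / n%:R * mu ^+ 2 / 100%:R ->
    L * (\sum_u \sum_v frail_through R k s E u v ^+ 2) <= mu ^+ 2 / 100%:R ->
    (forall u, #|nbrs E u|%:R <= 4%:R * p * n%:R) ->
    p * 'C(n, 2)%:R / 4%:R < #|E|%:R ->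
  good k c1 2%:R 1 64%:R E.
Proof.
move=> sE mu0 X1 HQ HW Hdeg Hsize; have /andP[k_gt0 kn] := k0.
have /andP[p0 p1] := p01.
have n0 : 0 < n%:R :> R by rewrite ltr0n (ltn_trans _ n1).
have En0 : E != finset.set0.
  apply: contraTneq Hsize => ->; rewrite cards0 -leNgt.
  by rewrite divr_ge0 // mulr_ge0 // ltW.
have rob (B : {set {set 'I_n}}) : #|B|%:R <= L ->
    exists2 D : {set 'I_n}, #|D| = k & dominating (E :\: B) D.
  move=> BL; apply: (robust_dominating (mu := mu) (L := L) (s := s)) => //;
  by rewrite ?card_ord // (ltn_trans _ n1).
have gE : domination_number E = k.
  apply/eqP; rewrite eqn_leq; apply/andP; split.
    have [|D Dk dD] := rob finset.set0; first by rewrite cards0 ltW.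
    by rewrite finset.setD0 in dD; rewrite -Dk domination_number_le.
  rewrite leqNgt; apply/negP => lt; move: X1; apply/negP; rewrite -leNgt.
  have [D dD Dk] := domination_number_ex E.
  have Dk1 : (#|D| <= k.-1)%N by rewrite Dk -ltnS prednK.
  (* A smaller dominating set is padded to exactly [k - 1] vertices, the only size counted in
     [X1]. *)
  have [D' DD' D'k] : exists2 D' : {set 'I_n}, D \subset D' & #|D'| = k.-1.
    have : (k.-1 - #|D| <= #|~: D|)%N.
      rewrite [X in (_ <= X)%N]cardsCs finset.setCK card_ord leq_sub2r //.
      by rewrite (leq_trans (leq_pred _)).
    case/card_geqP => t [ut st tD].
    exists (D :|: [set x in t]%SET); first exact: finset.subsetUl.
    rewrite cardsU (_ : D :&: _ = finset.set0) ?cards0 ?subn0.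
      by rewrite cardsE (card_uniqP ut) st subnKC.
    apply/setP => x; rewrite !inE; apply/negbTE/negP => /andP[xD xt].
    by have := tD x xt; rewrite inE xD.
  rewrite /dom_count (bigD1 D') ?D'k //= {1}/dom (dominatingS DD' dD) lerDl.
  by apply: sumr_ge0 => D1 _; rewrite /dom.
have Dle : (max_degree E)%:R <= 4%:R * p * n%:R.
  by apply: max_degree_le => //; rewrite !mulr_ge0 // ltW.
have bL : L <= (bondage_number E)%:R.
  rewrite leNgt; apply/negP => bL.
  have : (bondage_number E < bondage_number E)%N; last by rewrite ltnn.
  apply: (bondage_lb sE En0 gE) => B bB; apply: rob.
  by apply: le_trans (ltW bL); rewrite ler_nat.
rewrite /good gE eqxx /=; apply/and3P; split.
- apply/andP; split; first by apply: le_trans bL; apply: le_trans HL;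
    rewrite ler_pM2l.
  by rewrite -natrM ler_nat bondage_le_max_degree.
- rewrite mul1r ler_pdivrMr // -natrM ler_nat mulnC.
  by have := card_edges_le_max_degree sE; rewrite card_ord.
(* As [n - 1 >= n / 2], there are more than [p n ^ 2 / 16] edges; with the degree bound [4 p n] this
   gives 64 = 4 * 16. *)
- apply: le_trans Dle _; rewrite mulrA ler_pdivlMr //.
  move: Hsize; rewrite bin2_natr ?(ltnW n1) //.
  have : 2%:R <= n%:R :> R by rewrite ler_nat.
  move=> n2 Hs1; have : 0 <= p * n%:R * (n%:R - 2%:R).
    by rewrite !mulr_ge0 ?subr_ge0 // ltW.
  by lra.
Qed.

(** Markov's inequality and the union bound at once: the indicator of failure is at most a sum of
    five nonnegative functions, each at least 1 when its own hypothesis of [good_event] fails. The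
    degrees and the size are tilted exponentially, with bases [e] and [1 / e]. *)
Lemma good_prob (r mu : R) : r = 1 - p -> 0 < mu ->
  1 - (Ex (gw (T := 'I_n) r) (dom_count R k.-1) +
   Ex (gw r) (fun E : {set {set 'I_n}} => \sum_v (dom_through R k E v - k%:R * mu / n%:R) ^+ 2) /
     (k%:R / n%:R * mu ^+ 2 / 100%:R) +
   L * Ex (gw r) (fun E : {set {set 'I_n}} => \sum_u \sum_v frail_through R k s E u v ^+ 2) /
     (mu ^+ 2 / 100%:R) +
   n%:R * expR (- (p * n%:R)) + expR (- (p * 'C(n, 2)%:R / 4%:R))) <=
  Ex (gw r) (fun E : {set {set 'I_n}} => (good k c1 2%:R 1 64%:R E)%:R).
Proof.
move=> rE mu0; have /andP[k_gt0 kn] := k0; have /andP[p0 p1] := p01.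
have n0 : 0 < n%:R :> R by rewrite ltr0n (ltn_trans _ n1).
have r01 : 0 <= r <= 1 by rewrite rE; apply/andP; split; lra.
have pE : 1 - r = p by rewrite rE; ring.
set tQ := k%:R / n%:R * mu ^+ 2 / 100%:R; set tW := mu ^+ 2 / 100%:R.
have tW0 : 0 < tW by apply: divr_gt0 => //; apply: exprn_gt0.
have tQ0 : 0 < tQ.
  rewrite /tQ -mulrA -/tW; apply: mulr_gt0 => //.
  by apply: divr_gt0 => //; rewrite ltr0n.
pose Q (E : {set {set 'I_n}}) := \sum_v (dom_through R k E v - k%:R * mu / n%:R) ^+ 2.
pose W (E : {set {set 'I_n}}) := \sum_u \sum_v frail_through R k s E u v ^+ 2.
pose dg (E : {set {set 'I_n}}) :=
  \sum_u expR 1 ^+ #|nbrs E u| * expR (- (4%:R * p * n%:R)).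
pose sz (E : {set {set 'I_n}}) := expR (-1) ^+ #|all_edges 'I_n :&: E| *
  expR (p * 'C(n, 2)%:R / 4%:R).
have Q0 E : 0 <= Q E by apply: sumr_ge0 => v _; apply: sqr_ge0.
have W0 E : 0 <= W E.
  by apply: sumr_ge0 => u _; apply: sumr_ge0 => v _; apply: sqr_ge0.
have X0 (E : {set {set 'I_n}}) : 0 <= dom_count R k.-1 E by apply: sumr_ge0 => D _; rewrite /dom.
have dg0 E : 0 <= dg E.
  by apply: sumr_ge0 => u _; rewrite mulr_ge0 ?exprn_ge0 ?expR_ge0.
have sz0 E : 0 <= sz E by rewrite mulr_ge0 ?exprn_ge0 ?expR_ge0.
have e12 : expR (-1) <= 1 / 2 :> R.
  rewrite expRN -div1r ler_pM2l // lef_pV2 ?posrE ?expR_gt0 //.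
  by have := expR_ge1Dx (1 : R); lra.
have e4 := expR1_le4 R.
have Edg : Ex (gw r) dg <= n%:R * expR (- (p * n%:R)).
  rewrite Ex_sum; apply: (@le_trans _ _ (\sum_(u : 'I_n) expR (- (p * n%:R)))).
    apply: ler_sum => u _.
    rewrite (eq_Ex _ (g := fun E => expR (- (4%:R * p * n%:R)) *
      expR 1 ^+ #|nbrs E u|)); last by move=> E; rewrite mulrC.
    rewrite ExZ EG_degree pE card_ord.
    (* Since [e <= 4], each factor [r + p e] is at most [1 + 3 p <= exp (3 p)], leaving
       [exp (- p n)] after the tilt by [4 p n]. *)
    apply: (@le_trans _ _ (expR (- (4%:R * p * n%:R)) * expR (3%:R * p * n%:R))).
      rewrite ler_pM2l ?expR_gt0 //.
      apply: (@le_trans _ _ (expR (3%:R * p) ^+ n.-1)).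
        have := expR_gt0 (1 : R); have := expR_ge1Dx (3%:R * p) => h h0.
        apply: lerXn2r; rewrite ?nnegrE ?expR_ge0 //; last by rewrite rE; nra.
        by rewrite rE; nra.
      rewrite -expRM_natr ler_expR ler_wpM2l ?ler_nat ?leq_pred //.
      by rewrite mulr_ge0 // ltW.
    by rewrite -expRD ler_expR; lra.
  by rewrite sumr_const card_ord -[leLHS]mulr_natl.
have Esz : Ex (gw r) sz <= expR (- (p * 'C(n, 2)%:R / 4%:R)).
  rewrite (eq_Ex _ (g := fun E => expR (p * 'C(n, 2)%:R / 4%:R) *
    expR (-1) ^+ #|all_edges 'I_n :&: E|)); last by move=> E; rewrite /sz mulrC.
  rewrite ExZ EG_size pE card_ord.
  apply: (@le_trans _ _ (expR (p * 'C(n, 2)%:R / 4%:R) *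
    expR (- (p / 2)) ^+ 'C(n, 2))).
    rewrite ler_pM2l ?expR_gt0 //.
    have := expR_gt0 (-1 : R); have := expR_ge1Dx (- (p / 2)) => h h0.
    by apply: lerXn2r; rewrite ?nnegrE ?expR_ge0 // rE; nra.
  by rewrite -expRM_natr -expRD ler_expR; lra.
apply: (@le_trans _ _ (Ex (gw r) (fun E : {set {set 'I_n}} => 1 -
   (dom_count R k.-1 E + tQ^-1 * Q E + L / tW * W E + dg E + sz E)))).
  rewrite ExB !ExD ExC !ExZ.
  have -> : tQ^-1 * Ex (gw r) Q = Ex (gw r) Q / tQ by rewrite mulrC.
  have -> : L / tW * Ex (gw r) W = L * Ex (gw r) W / tW by rewrite mulrAC.
  by rewrite lerD2l lerN2 !lerD.
have tQi : 0 < tQ^-1 by rewrite invr_gt0.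
have LtW : 0 < L / tW by rewrite divr_gt0.
apply: (le_Ex (gw01 r01)) => E wE; have sE := pweight_edges wE.
have nE : all_edges 'I_n :&: E = E by apply/finset.setIidPr.
have [gd|ngd] := boolP (good k c1 2%:R 1 64%:R E).
  rewrite gerBl !addr_ge0 // mulr_ge0 // ltW //.
suff : 1 <= dom_count R k.-1 E + tQ^-1 * Q E + L / tW * W E + dg E + sz E.
  by move=> h; rewrite subr_le0.
have tQ_ge0 : 0 <= tQ^-1 * Q E by rewrite mulr_ge0 // ltW.
have tW_ge0 : 0 <= L / tW * W E by rewrite mulr_ge0 // ltW.
have := X0 E; have := dg0 E; have := sz0 E => z1 z2 z3.
have [X1|X1] := ltP (dom_count R k.-1 E) 1; last by lra.
have [Q1|Q1] := leP (Q E) tQ; last first.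
  have : 1 < tQ^-1 * Q E by rewrite mulrC ltr_pdivlMr // mul1r.
  by lra.
have [W1|W1] := leP (L * W E) tW; last first.
  have : 1 < L / tW * W E by rewrite mulrAC ltr_pdivlMr // mul1r.
  by lra.
have [S1|S1] := ltP (p * 'C(n, 2)%:R / 4%:R) #|E|%:R; last first.
  have : 1 <= sz E.
    rewrite /sz nE -expRM_natl -expRD -[leLHS]expR0 ler_expR; lra.
  by lra.
have [/forallP D1|/forallPn[u]] :=
    boolP [forall u, #|nbrs E u|%:R <= 4%:R * p * n%:R :> R].
  by case/negP: ngd; apply: (good_event sE mu0 X1 Q1 W1 D1 S1).
rewrite -ltNge => D1.
have : 1 <= dg E.
  rewrite /dg (bigD1 u) //= -[leLHS]addr0; apply: lerD; last first.
    by apply: sumr_ge0 => v _; rewrite mulr_ge0 ?exprn_ge0 ?expR_ge0.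
  by rewrite -expRM_natl -expRD -[leLHS]expR0 ler_expR; lra.
by lra.
Qed.

End GoodEvent.

(** * Numerical estimates *)

Section Binomials.
Local Open Scope nat_scope.

Lemma bin_le_expn m i : 'C(m, i) <= m ^ i.
Proof.
elim: i => [|i IH]; first by rewrite bin0.
rewrite -(leq_pmul2l (ltn0Sn i)) mul_bin_left.
apply: leq_trans (leq_mul (leq_subr i m) IH) _.
by rewrite -expnS leq_pmull.
Qed.

(** The ratio of the binomials is a product of factors [(k - j) / (m - j) <= k / m]. The case
    [i = k] is the bound ['C(m, k) >= (m / k) ^ k]. *)
Lemma bin_sub_le m k i : i <= k <= m ->
  'C(m - i, k - i) * m ^ i <= 'C(m, k) * k ^ i.
Proof.
elim: i => [|i IH] /andP[ik km]; first by rewrite !subn0.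
have mi : 0 < m - i by rewrite subn_gt0; apply: leq_trans km.
have := IH; rewrite (ltnW ik) km => /(_ isT) {}IH.
have e : (m - i) * 'C(m - i.+1, k - i.+1) = (k - i) * 'C(m - i, k - i).
  have := mul_bin_diag (m - i) (k - i.+1).
  by rewrite -subnS => ->; rewrite -subSn // subSS.
rewrite -(leq_pmul2l mi) mulnA e !expnS.
have h : (k - i) * m <= (m - i) * k by rewrite !mulnBl mulnC leq_sub2l // leq_mul2l km orbT.
have -> : (k - i) * 'C(m - i, k - i) * (m * m ^ i) =
  ((k - i) * m) * ('C(m - i, k - i) * m ^ i) by lia.
have -> : (m - i) * ('C(m, k) * (k * k ^ i)) =
  ((m - i) * k) * ('C(m, k) * k ^ i) by lia.
exact: leq_mul.
Qed.

End Binomials.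

(** * Tails of the hypergeometric overlap *)

Section Overlap.
Variables (R : realType) (n k : nat).
Hypothesis kn : (0 < k <= n)%N.

Lemma ovl_small i : (i <= k)%N ->
  ovl R 'I_n k i <= (k%:R ^+ 2 / n%:R) ^+ i.
Proof.
move=> ik; have /andP[k0 kn'] := kn; rewrite /ovl card_ord.
have n0 : (0 < n)%N by apply: leq_trans kn'.
have H : ('C(k, i) * 'C(n - k, k - i) * n ^ i <= (k ^ 2) ^ i * 'C(n, k))%N.
  have h := @bin_sub_le n k i; rewrite ik kn' in h; have {}h := h isT.
  have h' : ('C(n - k, k - i) * n ^ i <= 'C(n, k) * k ^ i)%N.
    by apply: leq_trans h; rewrite leq_mul2r leq_bin2l ?orbT //; apply: leq_sub2l.
  rewrite -mulnA (leq_trans (leq_mul (bin_le_expn k i) h')) // -expnM mul2n.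
  by rewrite -addnn expnD -mulnA [X in (_ * X <= _)%N]mulnC.
rewrite ler_pdivrMr ?ltr0n ?bin_gt0 // expr_div_n mulrAC.
by rewrite ler_pdivlMr ?exprn_gt0 ?ltr0n // -!natrX -!natrM ler_nat.
Qed.

(** For nearly equal sets: the second set arises from the first by exchanging [k - i] vertices, with
    at most [k] choices for each one removed and [n] for each one added. *)
Lemma ovl_large i : (i <= k)%N ->
  ovl R 'I_n k i <= (k%:R * n%:R) ^+ (k - i) / 'C(n, k)%:R.
Proof.
move=> ik; have /andP[k0 kn'] := kn; rewrite /ovl card_ord.
rewrite ler_pM2r ?invr_gt0 ?ltr0n ?bin_gt0 // -natrM -natrX ler_nat expnMn.
rewrite -(bin_sub ik) leq_mul ?bin_le_expn //.
rewrite (leq_trans (bin_le_expn _ _)) //.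
by case: (k - i)%N => [|j]; rewrite ?expn0 // leq_exp2r ?leq_subr.
Qed.

End Overlap.

(** * Choice of the edge probability and size of the parameters *)

Section Estimates.
Variables (R : realType) (n k : nat) (eps : R).
Local Notation N := (n%:R : R).
Local Notation K := (k%:R : R).
Local Notation l := (ln (n%:R : R)).
Local Notation G := (expR eps^-1).
Local Notation C := ('C(n, k)%:R : R).
(** [Kl3] is [k <= n ^ (1/3 - eps)] in logarithmic form, and [Gl] lets [n ^ (eps / 2)] absorb
    constants and powers of [ln n]. *)
Hypotheses (eps01 : 0 < eps <= 1) (l120 : 120%:R <= l) (K100 : 100%:R <= K).
Hypothesis epsK : eps * l <= K.
Hypothesis Kl3 : 3%:R * (ln K + eps * l) <= l.
Hypothesis Gl : 36%:R * G * l ^+ 4 <= expR (eps * l / 2).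

(* [miss_prob] is the probability that a vertex has no neighbour in a given
   [k]-set; this value makes the expected number of dominating [k]-sets about
   [n ^ 10], while that of dominating [k - 1]-sets is [exp (- c (ln n) ^ 2)]. *)
Definition miss_prob : R := (ln C - 10%:R * l) / N.
Definition rate : R := - ln miss_prob / K.
Definition nonedge : R := expR (- rate).
(* Two [k]-sets meeting in [i] vertices are positively correlated by a factor
   of about [exp (corr i)]. *)
Definition corr (i : nat) : R := N * miss_prob ^+ 2 * expR (rate * i%:R).

Local Notation q := miss_prob.
Local Notation a := rate.
Local Notation r := nonedge.
Local Notation y := corr.

Lemma l_gt0 : 0 < l.
Proof. exact: lt_le_trans l120. Qed.

Lemma K_gt0 : 0 < K.
Proof. exact: lt_le_trans K100. Qed.

Lemma N_gt0 : 0 < N.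
Proof.
have := l_gt0; case: (ltP 0 N) => // N0; rewrite ltNge ln_le0 //.
by rewrite (le_trans N0).
Qed.

Lemma NE : N = expR l. Proof. by rewrite lnK // posrE N_gt0. Qed.
Lemma KE : K = expR (ln K). Proof. by rewrite lnK // posrE K_gt0. Qed.

Lemma lnK_ge0 : 0 <= ln K.
Proof. by apply: ln_ge0; have := K100; lra. Qed.

Lemma epsl_gt0 : 0 < eps * l.
Proof. by have /andP[e0 _] := eps01; rewrite mulr_gt0 ?l_gt0. Qed.

Lemma G_ge1 : 1 <= G.
Proof.
have /andP[e0 _] := eps01.
have ei0 : 0 < eps^-1 by rewrite invr_gt0.
by have := expR_ge1Dx eps^-1; lra.
Qed.

Lemma l_le_nu : l <= expR (eps * l / 2).
Proof.
apply: le_trans Gl; have := G_ge1; have l0 := l120.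
have : l <= l ^+ 4 by rewrite -[leLHS]expr1 ler_weXn2l //; lra.
move=> h1 h2; apply: le_trans h1 _; apply: ler_peMl; last by lra.
by apply: exprn_ge0; lra.
Qed.

Lemma Kl_le : K * l <= expR (l / 3%:R).
Proof.
have h := l_le_nu; rewrite {1}KE.
apply: (@le_trans _ _ (expR (ln K) * expR (eps * l / 2))).
  by rewrite ler_pM2l ?expR_gt0.
by rewrite -expRD ler_expR; have := epsl_gt0; have := Kl3; lra.
Qed.

Lemma K_le_exp : K <= expR (l / 3%:R).
Proof. by rewrite KE ler_expR; have := epsl_gt0; have := Kl3; lra. Qed.

Lemma k_range : (0 < k)%N /\ (4 * k <= n)%N.
Proof.
split; first by have := K_gt0; rewrite ltr0n.
rewrite -(ler_nat R) natrM.
apply: (@le_trans _ _ (K * l)); first by have := K_gt0; have := l120; nra.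
apply: le_trans Kl_le _; rewrite [leRHS]NE ler_expR; have := l120; lra.
Qed.

Lemma k_bounds : (0 < k <= n)%N.
Proof. by have [-> /=] := k_range; apply: leq_trans; rewrite leq_pmull. Qed.

Lemma C_gt0 : 0 < C.
Proof. by rewrite ltr0n bin_gt0; case/andP: k_bounds. Qed.

Lemma lnC_le : ln C <= K * l.
Proof.
rewrite mulr_natl -lnXn ?N_gt0 // ler_ln ?posrE ?exprn_gt0 ?N_gt0 ?C_gt0 //.
by rewrite -natrX ler_nat bin_le_expn.
Qed.

Lemma lnC_ge : K * (l - ln K) <= ln C.
Proof.
have [k0 k_bounds'] := andP k_bounds; rewrite mulrBr lerBlDr.
rewrite !mulr_natl -!lnXn ?N_gt0 ?K_gt0 //.
rewrite -lnM ?posrE ?exprn_gt0 ?K_gt0 ?C_gt0 //.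
rewrite ler_ln ?posrE ?mulr_gt0 ?exprn_gt0 ?K_gt0 ?N_gt0 ?C_gt0 //.
rewrite -!natrX -natrM ler_nat.
by have := @bin_sub_le n k k; rewrite leqnn k_bounds' subnn bin0 mul1n; apply.
Qed.

Lemma NqE : N * q = ln C - 10%:R * l.
Proof. by rewrite /miss_prob mulrCA divff ?mulr1 // lt0r_neq0 // N_gt0. Qed.

Lemma CE : C = expR (N * q + 10%:R * l).
Proof. by rewrite NqE subrK lnK // posrE C_gt0. Qed.

Lemma Nq_le : N * q <= K * l.
Proof. by rewrite NqE; have := lnC_le; have := l120; lra. Qed.

Lemma Nq_ge : K * l / 2 <= N * q.
Proof.
rewrite NqE; have := lnC_ge; have := Kl3; have := epsl_gt0; have := l120.
have := K100 => h1 h2 h3 h4 h5.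
have h6 : 3%:R * ln K <= l by lra.
have : K * (3%:R * ln K) <= K * l by rewrite ler_pM2l // K_gt0.
by nra.
Qed.

Lemma q_ge : expR (- l) <= q.
Proof.
rewrite expRN -NE -div1r ler_pdivrMr ?N_gt0 // mulrC.
by apply: le_trans Nq_ge; have := l120; have := K100; nra.
Qed.

Lemma q_le : q <= expR (- (2%:R / 3%:R * l)).
Proof.
rewrite -(ler_pM2l N_gt0) {2}NE -expRD (le_trans Nq_le) //.
by apply: le_trans Kl_le _; rewrite ler_expR; lra.
Qed.

Lemma q_gt0 : 0 < q. Proof. exact: lt_le_trans (expR_gt0 _) q_ge. Qed.

Lemma Nq_gt0 : 0 < N * q. Proof. exact: mulr_gt0 N_gt0 q_gt0. Qed.

Lemma q_le_eighth : q <= 1 / 8%:R.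
Proof.
apply: le_trans q_le _; rewrite expRN -div1r ler_pM2l // lef_pV2 ?posrE ?expR_gt0 //.
by have := expR_ge1Dx (2%:R / 3%:R * l); have := l120; lra.
Qed.

Lemma qE : q = expR (ln q). Proof. by rewrite lnK // posrE q_gt0. Qed.

Lemma rateK : a * K = - ln q.
Proof. by rewrite /rate divfK // lt0r_neq0 // K_gt0. Qed.

(** As [q = r ^ k] lies between [1 / n] and [n ^ (- 2/3)], the rate [- ln (1 - p)] is of order
    [ln n / k]. *)
Lemma rateK_le : a * K <= l.
Proof. by rewrite rateK lerNl -ler_expR -qE q_ge. Qed.

Lemma rateK_ge : 2%:R / 3%:R * l <= a * K.
Proof. by rewrite rateK lerNr -ler_expR -qE q_le. Qed.

Lemma rate_gt0 : 0 < a.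
Proof.
by rewrite -(pmulr_lgt0 _ K_gt0) (lt_le_trans _ rateK_ge) //; have := l120; lra.
Qed.

(** The lower bound [epsK] on [k] enters here: it keeps the non-edge probability away from 0. *)
Lemma rate_le : a <= eps^-1.
Proof.
have /andP[e0 _] := eps01; rewrite -div1r ler_pdivlMr //.
rewrite -(ler_pM2r l_gt0) mul1r -mulrA.
apply: le_trans rateK_le; rewrite ler_pM2l ?rate_gt0 //.
Qed.

Lemma expRa_le : expR a <= G.
Proof. by rewrite ler_expR rate_le. Qed.

Lemma r_exp m : r ^+ m = expR (- (a * m%:R)).
Proof. by rewrite /nonedge -expRM_natr mulNr. Qed.

Lemma r_k : r ^+ k = q.
Proof. by rewrite r_exp rateK opprK -qE. Qed.

Lemma r01 : 0 <= r <= 1.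
Proof. by rewrite expR_ge0 -expR0 ler_expR oppr_le0 ltW // rate_gt0. Qed.

Lemma r_2ki i : (i <= k)%N -> r ^+ (2 * k - i) = q ^+ 2 * expR (a * i%:R).
Proof.
move=> ik; have ik2 : (i <= 2 * k)%N by rewrite mul2n -addnn (leq_trans ik) // leq_addr.
rewrite r_exp natrB // natrM qE -expRM_natl -expRD -[ln q]opprK -rateK.
by congr expR; ring.
Qed.

Lemma w_le : N * q ^+ 2 <= expR (- (l / 3%:R)).
Proof.
rewrite expr2 mulrA.
apply: (@le_trans _ _ (expR (l / 3%:R) * expR (- (2%:R / 3%:R * l)))).
  apply: ler_pM q_le; rewrite ?(ltW Nq_gt0) ?(ltW q_gt0) //.
  exact: le_trans Nq_le Kl_le.
by rewrite -expRD ler_expR; lra.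
Qed.

Lemma w_small : 41%:R * (N * q ^+ 2) <= 1.
Proof.
have := w_le; rewrite expRN => h.
have h2 : 41%:R <= expR (l / 3%:R).
  by have := expR_ge1Dx (l / 3%:R); have := l120; lra.
have h3 : expR (l / 3%:R) * (expR (l / 3%:R))^-1 = 1.
  by rewrite divff // lt0r_neq0 // expR_gt0.
have h4 : 0 < (expR (l / 3%:R))^-1 by rewrite invr_gt0 expR_gt0.
by nra.
Qed.

Lemma w_gt0 : 0 < N * q ^+ 2.
Proof. by rewrite mulr_gt0 ?exprn_gt0 ?N_gt0 ?q_gt0. Qed.

Lemma w_leKl : N * q ^+ 2 <= K ^+ 2 * l ^+ 2 / N.
Proof.
rewrite ler_pdivlMr ?N_gt0 // -exprMn.
have -> : N * q ^+ 2 * N = (N * q) ^+ 2 by ring.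
apply: lerXn2r; rewrite ?nnegrE ?Nq_le ?(ltW Nq_gt0) //.
by rewrite ltW // mulr_gt0 ?K_gt0 ?l_gt0.
Qed.

Lemma corr_gt0 i : 0 < y i.
Proof. by rewrite mulr_gt0 ?w_gt0 ?expR_gt0. Qed.

Lemma corr_ge i : N * q ^+ 2 <= y i.
Proof.
rewrite ler_peMr ?(ltW w_gt0) // -expR0 ler_expR mulr_ge0 //.
exact: ltW rate_gt0.
Qed.

(** The correlation seen from coinciding sets, where it equals [n q]; this form serves for large
    overlaps. *)
Lemma corr_sym i : (i <= k)%N -> y i = N * q * expR (- (a * (k - i)%N%:R)).
Proof.
move=> ik; rewrite /corr expr2 mulrA -mulrA; congr (_ * _).
by rewrite {1}qE -expRD natrB // -[ln q]opprK -rateK; congr expR; ring.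
Qed.

(** The slack in [m] covers both uses: all vertices outside the union for the variance, and one
    fewer when a frail vertex is set aside. *)
Lemma dom_pair_ratio i m : (i <= k)%N -> (n <= m + (2 * k + 1))%N ->
  (1 - 2 * r ^+ k + r ^+ (2 * k - i)) ^+ m <=
  expR (7%:R * (N * q ^+ 2) + y i) * ((1 - r ^+ k) ^+ (n - k)) ^+ 2.
Proof.
move=> ik nm; rewrite r_k (r_2ki ik).
have q0 := q_gt0; have q4 := q_le_eighth; have N0 := N_gt0.
have qe1 : q * expR (a * i%:R) <= 1.
  rewrite {1}qE -expRD -[leRHS]expR0 ler_expR -[ln q]opprK -rateK.
  have : a * i%:R <= a * K by rewrite ler_pM2l ?rate_gt0 // ler_nat.
  lra.
have qe0 : 0 < q * expR (a * i%:R) by rewrite mulr_gt0 // expR_gt0.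
set x := -2 * q + q ^+ 2 * expR (a * i%:R).
have x0 : x <= 0 by rewrite /x expr2 -mulrA; nra.
apply: (@le_trans _ _ (expR (x * m%:R))).
  rewrite [leRHS]expRM_natr; apply: lerXn2r; rewrite ?nnegrE ?expR_ge0 //.
    by rewrite expr2 -mulrA; nra.
  by have := expR_ge1Dx x; rewrite /x; lra.
have lb : expR (- (2%:R * (q + q ^+ 2)) * N) <= ((1 - q) ^+ (n - k)) ^+ 2.
  have -> : - (2%:R * (q + q ^+ 2)) * N = 2%:R * (N * - (q + q ^+ 2)) by ring.
  have q1 : 0 <= 1 - q by lra.
  rewrite !expRM_natl; apply: lerXn2r; rewrite ?nnegrE ?exprn_ge0 ?expR_ge0 //.
  apply: (@le_trans _ _ ((1 - q) ^+ n)).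
    apply: lerXn2r; rewrite ?nnegrE ?expR_ge0 //.
    by apply: expR_le_1B; rewrite q4 ltW.
  by rewrite ler_wiXn2l ?leq_subr //; lra.
apply: le_trans (ler_wpM2l (expR_ge0 _) lb); rewrite -expRD ler_expR.
have mN : N <= m%:R + (2%:R * K + 1) by rewrite -natrM -[1]/(1%:R) -!natrD ler_nat.
have h1 : x * m%:R <= x * (N - (2%:R * K + 1)).
  by rewrite ler_wnM2l // lerBlDr.
apply: le_trans h1 _.
have h2 : N * (q ^+ 2 * expR (a * i%:R)) = y i by rewrite /corr; ring.
have h3 : 0 <= q ^+ 2 * expR (a * i%:R) by rewrite mulr_ge0 ?exprn_ge0 ?expR_ge0 // ltW.
(* Replacing [m] by [n] costs [(4 k + 2) q], at most [5 n q ^ 2] because [n q >= k l / 2]. With the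
   [2 n q ^ 2] from [expR_le_1B] this makes the constant 7. *)
have h4 : (4%:R * K + 2%:R) * q <= 5%:R * (N * q ^+ 2).
  have -> : 5%:R * (N * q ^+ 2) = 5%:R * (N * q) * q by ring.
  rewrite ler_pM2r //; have := Nq_ge; have := l120; have := K100; nra.
have h5 : 0 <= (2%:R * K + 1) * (q ^+ 2 * expR (a * i%:R)).
  by rewrite mulr_ge0 //; have := K100; lra.
move: h2 h3 h4 h5; rewrite /x; set z := q ^+ 2 * expR _ => h2 h3 h4 h5.
by lra.
Qed.

Lemma rho_le i :
  expR (7%:R * (N * q ^+ 2) + y i) <= 2 * expR (y i).
Proof.
rewrite expRD ler_pM2r ?expR_gt0 //; apply: le_trans (expR_half_le2 R).
by rewrite ler_expR; have := w_small; lra.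
Qed.

Lemma rhoB1_le i :
  expR (7%:R * (N * q ^+ 2) + y i) - 1 <= 16%:R * (y i * expR (y i)).
Proof.
set x := 7%:R * _ + _.
have x8 : x <= 8%:R * y i by rewrite /x; have := corr_ge i; lra.
have x0 : 0 <= x by rewrite /x; have := w_gt0; have := corr_gt0 i; lra.
apply: (@le_trans _ _ (x * expR x)).
  have h := expR_ge1Dx (- x).
  have h2 : expR (- x) * expR x = 1 by rewrite -expRD addNr expR0.
  by have := expR_gt0 x; nra.
apply: (@le_trans _ _ (8%:R * y i * (2 * expR (y i)))); last by lra.
by apply: ler_pM => //; rewrite ?expR_ge0 ?rho_le.
Qed.


(** * Sums over the overlap size *)

Local Notation x0 := (K ^+ 2 / N).

Lemma x0_le : x0 <= expR (- (l / 3%:R)).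
Proof.
rewrite ler_pdivrMr ?N_gt0 // [X in _ <= _ * X]NE -expRD.
apply: (@le_trans _ _ (expR (l / 3%:R) ^+ 2)); last first.
  by rewrite -expRM_natl ler_expR; lra.
by apply: lerXn2r; rewrite ?nnegrE ?expR_ge0 ?(ltW K_gt0) ?K_le_exp.
Qed.

Lemma x0_gt0 : 0 < x0.
Proof. by apply: divr_gt0; [apply: exprn_gt0; exact: K_gt0|exact: N_gt0]. Qed.

Lemma x0Kl : K ^+ 2 * l <= N.
Proof.
apply: (@le_trans _ _ (K * l * (K * l))).
  by have := K_gt0; have := l120; nra.
apply: (@le_trans _ _ (expR (l / 3%:R) * expR (l / 3%:R))).
  have h : 0 <= K * l by rewrite mulr_ge0 ?(ltW l_gt0).
  by apply: ler_pM => //; exact: Kl_le.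
by rewrite -expRD [leRHS]NE ler_expR; have := l120; lra.
Qed.

(** Up to constants, what pairs with overlap [i] add to the variance, by [rhoB1_le]. The same term
    bounds the frail pairs up to a small power of [n], since there the sum over [u] turns
    [q ^ 2 exp (a i)] into [corr i]. *)
Definition overlap_term i : R := ovl R 'I_n k i * (i%:R * (y i * expR (y i))).

Lemma icorr_ge0 i : 0 <= i%:R * y i.
Proof. by apply: mulr_ge0 => //; apply: ltW; exact: corr_gt0. Qed.

Lemma ovl_ge0 i : 0 <= ovl R 'I_n k i.
Proof. by rewrite /ovl divr_ge0. Qed.

(** With [exp (corr i) <= 4], the growth [exp (a i)] of the correlation and the decay [x0 ^ i] of
    the overlap probability combine into a geometric series. *)
Lemma overlap_term_small i : (i <= k)%N -> y i <= 1 -> x0 * expR a <= 1 / 4%:R ->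
  overlap_term i <= 8%:R * (N * q ^+ 2) * (x0 * expR a) * (1 / 2) ^+ i.
Proof.
move=> ik y1 t4; set t := x0 * expR a in t4 *.
have t0 : 0 <= t by rewrite mulr_ge0 ?expR_ge0 // ltW // x0_gt0.
apply: (@le_trans _ _ (x0 ^+ i * (i%:R * (y i * 4%:R)))).
  apply: ler_pM; rewrite ?ovl_ge0 ?(ovl_small R k_bounds) //.
    by rewrite mulrA; apply: mulr_ge0 (expR_ge0 _); exact: icorr_ge0.
  apply: ler_wpM2l => //; apply: ler_wpM2l; first exact: ltW (corr_gt0 i).
  by apply: le_trans (expR1_le4 R); rewrite ler_expR.
have -> : x0 ^+ i * (i%:R * (y i * 4%:R)) =
  4%:R * (N * q ^+ 2) * (i%:R * t ^+ i).
  have tE : t ^+ i = x0 ^+ i * expR (a * i%:R) by rewrite expRM_natr -exprMn.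
  by rewrite tE /corr; ring.
have h := natr_exp_le (t := t) i; rewrite t0 t4 in h; have {}h := h isT.
have -> : 8%:R * (N * q ^+ 2) * t * (1 / 2) ^+ i =
  4%:R * (N * q ^+ 2) * (2 * t * (1 / 2) ^+ i) by ring.
by apply: ler_wpM2l => //; have := w_gt0; lra.
Qed.

Lemma corr_gt1_large i : (i <= k)%N -> 1 < y i -> K <= 3%:R * i%:R.
Proof.
move=> ik y1.
have h : 1 < expR (- (l / 3%:R)) * expR (a * i%:R).
  apply: lt_le_trans y1 _; rewrite /corr ler_pM2r ?expR_gt0 //.
  exact: w_le.
rewrite -expRD -[ltLHS]expR0 ltr_expR in h.
by rewrite -(ler_pM2l rate_gt0); have := rateK_le; lra.
Qed.

(* When [corr i > 1] the sets share at least a third of their vertices. Either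
   [corr i] is still small compared with [K l], and [ovl k i] compensates, or the
   sets are so close that [ovl k i] is about [n ^ - 10 * exp (- N q)]. *)
Lemma overlap_term_large i : (i <= k)%N -> 1 < y i ->
  overlap_term i <= expR (- (3%:R * l)).
Proof.
move=> ik y1; have iK := corr_gt1_large ik y1; have ys := corr_sym ik.
have l0 := l120; have K0 := K100; have q0 := Nq_gt0.
set j := (k - i)%N in ys; have jE : j%:R = K - i%:R by rewrite /j natrB.
have ej0 : expR (- (a * j%:R)) <= 1.
  by rewrite -[leRHS]expR0 ler_expR oppr_le0; apply: mulr_ge0 => //; exact: ltW rate_gt0.
have iy : i%:R * y i <= expR l.
  rewrite -NE; apply: le_trans x0Kl.
  have -> : K ^+ 2 * l = K * (K * l) by ring.
  apply: ler_pM => //; rewrite ?ler_nat ?(ltW (corr_gt0 i)) //.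
  by apply: le_trans Nq_le; rewrite ys; have := expR_gt0 (- (a * j%:R)); nra.
have tE : overlap_term i = ovl R 'I_n k i * (i%:R * y i) * expR (y i).
  by rewrite /overlap_term; ring.
(* In the first case [exp (K l / 20)] from the correlation loses against [exp (- K l / 9)] from an
   overlap of at least [K / 3]. *)
have [e20|e20] := leP (expR (- (a * j%:R))) (1 / 20%:R).
  have yl : y i <= K * l / 20%:R.
    by rewrite ys; have := Nq_le; have := expR_gt0 (- (a * j%:R)); nra.
  have ol : ovl R 'I_n k i <= expR (- (K * l / 9%:R)).
    apply: le_trans (ovl_small R k_bounds ik) _.
    apply: (@le_trans _ _ (expR (- (l / 3%:R)) ^+ i)).
      by apply: lerXn2r; rewrite ?nnegrE ?expR_ge0 ?x0_le ?(ltW x0_gt0).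
    by rewrite -expRM_natl ler_expR; nra.
  apply: (@le_trans _ _ (expR (- (K * l / 9%:R)) * expR l * expR (K * l / 20%:R))).
    rewrite tE; apply: ler_pM; rewrite ?expR_ge0 ?ler_expR //.
      by apply: mulr_ge0 (icorr_ge0 i); exact: ovl_ge0.
    by apply: ler_pM; rewrite ?ovl_ge0 ?icorr_ge0.
  by rewrite -!expRD ler_expR; nra.
have ol : ovl R 'I_n k i <= expR (2%:R * l * j%:R - (N * q + 10%:R * l)).
  apply: le_trans (ovl_large R k_bounds ik) _; rewrite expRD expRN -CE.
  rewrite ler_pM2r ?invr_gt0 ?C_gt0 // expRM_natr.
  apply: lerXn2r; rewrite ?nnegrE ?expR_ge0 ?mulr_ge0 //.
  rewrite (_ : 2%:R * l = l + l) ?expRD -?NE; last by ring.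
  by apply: ler_pM => //; rewrite ler_nat; case/andP: k_bounds.
apply: (@le_trans _ _ (expR (2%:R * l * j%:R - (N * q + 10%:R * l)) * expR l *
    expR (y i))).
  rewrite tE; apply: ler_wpM2r; rewrite ?expR_ge0 //.
  by apply: ler_pM; rewrite ?ovl_ge0 ?icorr_ge0.
rewrite -!expRD ler_expR ys.
have aj0 : 0 <= a * j%:R by apply: mulr_ge0 => //; exact: ltW rate_gt0.
(* The gain [N q (1 - exp (- a j))] must beat the [2 l j] from counting exchanges. By concavity it
   is at least [N q a j / 20], hence at least [l ^ 2 j / 60], which suffices as [l >= 120]. *)
have h1 : a * j%:R * expR (- (a * j%:R)) <= 1 - expR (- (a * j%:R)).
  have h := expR_ge1Dx (a * j%:R).
  have h2 : expR (- (a * j%:R)) * expR (a * j%:R) = 1.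
    by rewrite -expRD addNr expR0.
  by have := expR_gt0 (- (a * j%:R)); nra.
have h2 : a * j%:R / 20%:R <= 1 - expR (- (a * j%:R)) by nra.
have h3 : K * l / 2 * (a * j%:R / 20%:R) <=
    N * q * (1 - expR (- (a * j%:R))).
  apply: ler_pM => //; [by have := K_gt0; nra|by lra|exact: Nq_ge].
have h4 : l * l * j%:R / 60%:R <= K * l / 2 * (a * j%:R / 20%:R).
  have -> : K * l / 2 * (a * j%:R / 20%:R) = a * K * (l * j%:R / 40%:R) by field.
  have -> : l * l * j%:R / 60%:R = 2%:R / 3%:R * l * (l * j%:R / 40%:R) by field.
  apply: ler_wpM2r; last exact: rateK_ge.
  by rewrite divr_ge0 // mulr_ge0 //; lra.
have h5 : 2%:R * l * j%:R <= l * l * j%:R / 60%:R.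
  have : 0 <= (l - 120%:R) * (l * j%:R) by rewrite !mulr_ge0 //; lra.
  by lra.
by lra.
Qed.

Local Notation nu := (expR (eps * l)).
Local Notation mu := (expdom 'I_n r k).
Local Notation EG := (Ex (gw (T := 'I_n) r)).

Lemma epsl_le : eps * l <= l / 3%:R.
Proof. by have := Kl3; have := lnK_ge0; lra. Qed.

Lemma Glm_le m : (m <= 4)%N -> 36%:R * G * l ^+ m <= expR (eps * l / 2).
Proof.
move=> m4; apply: le_trans Gl; apply: ler_wpM2l.
  by have := G_ge1; lra.
by apply: ler_weXn2l => //; have := l120; lra.
Qed.

Lemma G_le : 36%:R * G <= expR (l / 6%:R).
Proof.
have := Glm_le (m := 0) isT; rewrite expr0 mulr1 => h; apply: le_trans h _.
by rewrite ler_expR; have := epsl_le; lra.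
Qed.

Lemma l2_le : l ^+ 2 <= expR (eps * l / 2).
Proof.
apply: le_trans (Glm_le (m := 2) isT); apply: ler_peMl.
  by apply: exprn_ge0; exact: ltW l_gt0.
by have := G_ge1; lra.
Qed.

Lemma K3_le : K ^+ 3 <= expR (l - 3%:R * (eps * l)).
Proof.
rewrite {1}KE -expRM_natl ler_expR; have := Kl3; lra.
Qed.

Lemma x0expa_le : x0 * expR a <= 1 / 4%:R.
Proof.
apply: (@le_trans _ _ (expR (- (l / 3%:R)) * expR (l / 6%:R))).
  apply: ler_pM; rewrite ?expR_ge0 ?(ltW x0_gt0) ?x0_le //.
  apply: le_trans expRa_le _; have := G_le; have := G_ge1; lra.
rewrite -expRD (_ : _ + _ = - (l / 6%:R)); last by field.
rewrite expRN -div1r ler_pM2l // lef_pV2 ?posrE ?expR_gt0 //.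
by have := expR_ge1Dx (l / 6%:R); have := l120; lra.
Qed.

(** Small overlaps contribute about [n q ^ 2 * (k ^ 2 / n)], at most [(k / n) (k ^ 3 l ^ 2 / n)];
    here [k ^ 3 <= n ^ (1 - 3 eps)] yields the factor [n ^ (- eps)]. *)
Lemma sum_overlap_term :
  \sum_(i < k.+1) overlap_term i <= K / N / nu.
Proof.
set A := 8%:R * (N * q ^+ 2) * (x0 * expR a).
have t0 : 0 <= x0 * expR a by apply: mulr_ge0 (expR_ge0 _); exact: ltW x0_gt0.
have A0 : 0 <= A by apply: mulr_ge0 => //; have := w_gt0; lra.
apply: (@le_trans _ _ (\sum_(i < k.+1) (A * (1 / 2) ^+ i + expR (- (3%:R * l))))).
  apply: ler_sum => i _; have ik : (i <= k)%N by rewrite -ltnS.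
  have B0 := expR_ge0 (- (3%:R * l)).
  have A1 : 0 <= A * (1 / 2) ^+ i by apply: mulr_ge0 => //; apply: exprn_ge0.
  have [y1|y1] := leP (y i) 1.
    by have := overlap_term_small ik y1 x0expa_le; rewrite -/A; lra.
  by have := overlap_term_large ik y1; lra.
rewrite big_split /= -mulr_sumr sumr_const card_ord -[expR _ *+ _]mulr_natr.
have s2 : A * \sum_(i < k.+1) (1 / 2) ^+ i <= A * 2.
  by apply: ler_wpM2l => //; apply: sum_half.
have KN : 0 < K / N by apply: divr_gt0; [exact: K_gt0|exact: N_gt0].
have key : 32%:R * G * l ^+ 2 * K ^+ 3 * nu <= N.
  have h : 32%:R * G * l ^+ 2 <= expR (eps * l / 2).
    apply: le_trans (Glm_le (m := 2) isT).
    apply: ler_wpM2r; first by apply: exprn_ge0; exact: ltW l_gt0.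
    by have := G_ge1; lra.
  apply: (@le_trans _ _ (expR (eps * l / 2) * expR (l - 3%:R * (eps * l)) * nu)).
    apply: ler_wpM2r (expR_ge0 _) _ _ _; apply: ler_pM h K3_le.
      rewrite mulr_ge0 ?exprn_ge0 ?(ltW l_gt0) //; have := G_ge1; lra.
    by rewrite exprn_ge0 ?(ltW K_gt0).
  by rewrite -!expRD [leRHS]NE ler_expR; have := epsl_gt0; lra.
have A2 : A * 2 <= K / N / nu / 2.
  apply: (@le_trans _ _ (8%:R * (K ^+ 2 * l ^+ 2 / N) * (x0 * G) * 2)).
    apply: ler_wpM2r => //; apply: ler_pM => //.
    - by have := w_gt0; lra.
    - by have := w_leKl; lra.
    - by apply: ler_wpM2l; [exact: ltW x0_gt0|exact: expRa_le].
  have nu0 : 0 < nu := expR_gt0 _; have N0 := N_gt0.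
  have -> : 8%:R * (K ^+ 2 * l ^+ 2 / N) * (x0 * G) * 2 =
     (K / N / nu / 2) * (32%:R * G * l ^+ 2 * K ^+ 3 * nu / N).
    by field; rewrite !lt0r_neq0.
  rewrite -[leRHS]mulr1; apply: ler_wpM2l; last by rewrite ler_pdivrMr // mul1r.
  by rewrite !mulr_ge0 ?invr_ge0 ?(ltW nu0) ?(ltW N0).
have B2 : expR (- (3%:R * l)) * k.+1%:R <= K / N / nu / 2.
  have -> : K / N / nu / 2 = K * (expR (- l - eps * l) / 2).
    by rewrite expRD !expRN -NE; ring.
  have e1 : expR (- (3%:R * l)) * 4%:R <= expR (- l - eps * l).
    have -> : - l - eps * l = - (3%:R * l) + (2 * l - eps * l) by ring.
    rewrite expRD; apply: ler_wpM2l; first exact: expR_ge0.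
    by have := expR_ge1Dx (2 * l - eps * l); have := epsl_le; have := l120; lra.
  have e0 := expR_ge0 (- (3%:R * l)); rewrite -[k.+1%:R]natr1; have K1 := K100.
  have h1 : K * (expR (- (3%:R * l)) * 4%:R) <= K * expR (- l - eps * l).
    by apply: ler_wpM2l.
  have h2 : 0 <= (K - 1) * expR (- (3%:R * l)) by apply: mulr_ge0 => //; lra.
  by lra.
apply: le_trans (lerD (le_trans s2 A2) B2) _.
by rewrite -splitr.
Qed.

Lemma mu_gt0 : 0 < mu.
Proof.
rewrite /expdom card_ord r_k; apply: mulr_gt0; first exact: C_gt0.
by apply: exprn_gt0; have := q_le_eighth; lra.
Qed.

Lemma variance_bound :
  EG (fun E => \sum_v (dom_through R k E v - K * mu / N) ^+ 2) <=
  mu ^+ 2 * (16%:R * (K / N / nu)).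
Proof.
pose rho i := expR (7%:R * (N * q ^+ 2) + y i).
have := @EG_variance R 'I_n r r01 k rho; rewrite card_ord k_bounds => h.
have {}h := h isT; apply: le_trans (h _ _) _.
- move=> i; rewrite -[leLHS]expR0 ler_expR.
  by have := w_gt0; have := corr_gt0 i; lra.
- by move=> i ik; apply: dom_pair_ratio => //; clear; lia.
apply: ler_wpM2l; first exact: sqr_ge0.
apply: (@le_trans _ _ (\sum_(i < k.+1) 16%:R * overlap_term i)).
  apply: ler_sum => i _; rewrite /overlap_term [leRHS]mulrCA.
  apply: ler_wpM2l; first exact: ovl_ge0.
  by rewrite [leRHS]mulrCA; apply: ler_wpM2l => //; exact: rhoB1_le.
by rewrite -mulr_sumr; apply: ler_wpM2l => //; exact: sum_overlap_term.
Qed.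

(** * Vertices with few neighbours in a dominating set *)

Definition damp : R := eps / (16%:R * G).
(** Two costs of [n ^ (eps / 8)] are allowed: [damp] is small enough that tilting the [2 k - i]
    potential edges costs no more ([damp_gen]), and then [degfrac] is small enough for the charge
    [c ^- (2 * s)] ([damp_pow]). *)
Definition degfrac : R := eps / (16%:R * ln damp^-1).
Local Notation c := damp.
Local Notation delta := degfrac.
Local Notation s := (Num.truncn (delta * l)).

Lemma damp_gt0 : 0 < c.
Proof.
by have /andP[e0 _] := eps01; apply: divr_gt0 => //; have := G_ge1; lra.
Qed.

Lemma damp_le : c <= 1 / 16%:R.
Proof.
have /andP[e0 e1] := eps01; have g1 := G_ge1.
by rewrite /damp ler_pdivrMr; lra.
Qed.

Lemma lndamp_gt0 : 0 < ln c^-1.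
Proof.
by apply: ln_gt0; rewrite invf_gt1 ?damp_gt0 //; have := damp_le; lra.
Qed.

Lemma degfrac_gt0 : 0 < delta.
Proof.
have /andP[e0 _] := eps01; apply: divr_gt0 => //.
by apply: mulr_gt0 => //; exact: lndamp_gt0.
Qed.

Lemma trunc_bounds : s%:R <= delta * l < s.+1%:R.
Proof. by apply: truncn_itv; rewrite ltW // mulr_gt0 ?degfrac_gt0 ?l_gt0. Qed.

Lemma damp_pow : c ^- (2 * s) <= expR (eps * l / 8%:R).
Proof.
have -> : c ^- (2 * s) = expR (ln c^-1 * (2 * s)%:R).
  by rewrite expRM_natr lnK ?posrE ?invr_gt0 ?damp_gt0 // exprVn.
rewrite ler_expR natrM.
have -> : eps * l / 8%:R = ln c^-1 * (2 * (delta * l)).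
  by rewrite /degfrac; field; rewrite lt0r_neq0 // lndamp_gt0.
apply: ler_wpM2l; first exact: ltW lndamp_gt0.
by have /andP[h _] := trunc_bounds; lra.
Qed.

(** Each factor exceeds [r] by the ratio [1 + c (exp a - 1) <= exp (c a G)]. Being linear in [a],
    the exponent sums over at most [2 k] factors to a multiple of [a k <= l]. *)
Lemma damp_gen i : (i <= k)%N ->
  (r + (1 - r) * c) ^+ (2 * k - i) <=
  expR (eps * l / 8%:R) * r ^+ (2 * k - i).
Proof.
move=> ik; have c0 := damp_gt0; have a0 := rate_gt0; have g1 := G_ge1.
have ra : r * expR a = 1 by rewrite /nonedge -expRD addNr expR0.
have r0 : 0 < r := expR_gt0 _.
have h : r + (1 - r) * c <= r * expR (c * a * G).
  have e1 := expR_ge1Dx (c * a * G).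
  have e2 : expR a - 1 <= a * G.
    have h1 := expR_ge1Dx (- a); have h2 : expR (- a) * expR a = 1.
      by rewrite -expRD addNr expR0.
    have : a * expR a <= a * G by rewrite ler_pM2l // expRa_le.
    by have := expR_gt0 a; nra.
  have -> : r + (1 - r) * c = r * (1 + c * (expR a - 1)).
    transitivity (r + c * (r * expR a - r)); last by ring.
    by rewrite ra; ring.
  rewrite ler_pM2l //; apply: le_trans e1; rewrite lerD2l -mulrA.
  by apply: ler_wpM2l => //; exact: ltW.
have lhs0 : 0 <= r + (1 - r) * c.
  by have /andP[_ r1] := r01; rewrite addr_ge0 ?(ltW r0) // mulr_ge0 ?(ltW c0) // subr_ge0.
apply: (@le_trans _ _ ((r * expR (c * a * G)) ^+ (2 * k - i))).
  by apply: lerXn2r; rewrite ?nnegrE // mulr_ge0 ?expR_ge0.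
rewrite exprMn mulrC; apply: ler_wpM2r; first by rewrite exprn_ge0 ?expR_ge0.
rewrite -expRM_natr ler_expR.
apply: (@le_trans _ _ (c * a * G * (2 * K))).
  apply: ler_wpM2l; last by rewrite -natrM ler_nat leq_subr.
  by apply: mulr_ge0 (expR_ge0 _); apply: mulr_ge0; exact: ltW.
have -> : c * a * G * (2 * K) = eps / 8%:R * (a * K).
  by rewrite /damp; field; rewrite lt0r_neq0 // expR_gt0.
have -> : eps * l / 8%:R = eps / 8%:R * l by ring.
apply: ler_wpM2l; last exact: rateK_le.
by have /andP[e0 _] := eps01; rewrite divr_ge0 // ltW.
Qed.

Lemma lowdeg_bound :
  EG (fun E => \sum_u \sum_v frail_through R k s E u v ^+ 2) <=
  mu ^+ 2 * (4%:R * expR (eps * l / 4%:R) * (K / N / nu)).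
Proof.
pose beta i := expR (eps * l / 4%:R) * (q ^+ 2 * expR (a * i%:R)) *
  (2 * expR (y i)).
have b0 i : 0 <= beta i.
  apply: mulr_ge0; last by rewrite mulr_ge0 ?expR_ge0.
  apply: mulr_ge0; first exact: expR_ge0.
  by apply: mulr_ge0 (expR_ge0 _); exact: sqr_ge0.
have c01 : 0 < c <= 1 by rewrite damp_gt0; have := damp_le; lra.
have := @EG_lowdeg R 'I_n r r01 k s c beta; rewrite card_ord.
have [_ k_bounds'] := andP k_bounds => h.
apply: le_trans (h k_bounds' c01 b0 _) _.
  move=> i ik; rewrite mulrA.
  set P2 := ((1 - r ^+ k) ^+ (n - k)) ^+ 2.
  have P20 : 0 <= P2 by exact: sqr_ge0.
  have -> : beta i * P2 = expR (eps * l / 4%:R) * r ^+ (2 * k - i) *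
      (2 * expR (y i) * P2) by rewrite (r_2ki ik) /beta; ring.
  have rg : 0 <= r ^+ (2 * k - i) by apply: exprn_ge0; exact: expR_ge0.
  have B : (1 - 2 * r ^+ k + r ^+ (2 * k - i)) ^+ (n - (2 * k - i) - 1) <=
      2 * expR (y i) * P2.
    apply: le_trans (dom_pair_ratio ik _) _; first by clear; lia.
    by apply: ler_wpM2r => //; exact: rho_le.
  apply: (@le_trans _ _ (expR (eps * l / 4%:R) * r ^+ (2 * k - i) *
    (1 - 2 * r ^+ k + r ^+ (2 * k - i)) ^+ (n - (2 * k - i) - 1))).
    apply: ler_wpM2r.
      apply: exprn_ge0; rewrite r_k; have := q_le_eighth; lra.
    have -> : eps * l / 4%:R = eps * l / 8%:R + eps * l / 8%:R by field.
    rewrite expRD -mulrA; apply: ler_pM; last exact: damp_gen.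
    - by rewrite invr_ge0; apply: exprn_ge0; exact: ltW damp_gt0.
    - apply: exprn_ge0; have /andP[r0 r1] := r01; have := damp_gt0 => c0.
      by rewrite addr_ge0 // mulr_ge0 ?subr_ge0 // ltW.
    - exact: damp_pow.
  apply: ler_wpM2l B; apply: mulr_ge0 => //; exact: expR_ge0.
apply: ler_wpM2l; first exact: sqr_ge0.
apply: (@le_trans _ _ (\sum_(i < k.+1) 2 * expR (eps * l / 4%:R) *
    overlap_term i)); last first.
  rewrite -mulr_sumr; apply: (@le_trans _ _
    (2 * expR (eps * l / 4%:R) * (K / N / nu))).
    by apply: ler_wpM2l; [rewrite mulr_ge0 ?expR_ge0|exact: sum_overlap_term].
  apply: ler_wpM2r; last by apply: ler_wpM2r; [exact: expR_ge0|lra].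
  by apply: mulr_ge0; rewrite ?invr_ge0 ?expR_ge0 // divr_ge0.
apply: ler_sum => i _; rewrite le_eqVlt; apply/orP; left; apply/eqP.
by rewrite /overlap_term /beta /corr; ring.
Qed.

Lemma inv_l_ge x : l <= x -> expR (- x) <= l^-1.
Proof.
move=> lx; rewrite expRN lef_pV2 ?posrE ?expR_gt0 ?l_gt0 //.
by apply: le_trans lx _; have := expR_ge1Dx x; lra.
Qed.

(** Passing to [k - 1] multiplies [q] by [exp a], so the exponent [n q] grows by at least
    [n q a >= l ^ 2 / 3], which exceeds the surplus [10 l]; restricting to vertices outside the set
    costs at most 1. *)
Lemma smaller_bound : EG (dom_count R k.-1) <= l^-1.
Proof.
rewrite EG_dom_count ?r01 // /expdom card_ord.
have [k0 k_bounds'] := andP k_bounds; have [_ k4] := k_range.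
have binle : ('C(n, k.-1) <= 'C(n, k))%N.
  rewrite -(leq_pmul2l k0) -[X in (_ <= X * _)%N](prednK k0).
  rewrite -[X in (_ <= _ * 'C(_, X))%N](prednK k0) mul_bin_left.
  by rewrite leq_mul2r; apply/orP; right; lia.
have a0 := rate_gt0; have q0 := q_gt0.
have rk1 : r ^+ k.-1 = q * expR a.
  have ra : r * expR a = 1 by rewrite /nonedge -expRD addNr expR0.
  by rewrite -r_k -[in RHS](prednK k0) exprS mulrAC ra mul1r.
have small : q * expR a * K <= 1.
  apply: (@le_trans _ _ (expR (- (2%:R / 3%:R * l)) * expR (l / 6%:R) *
     expR (l / 3%:R))).
    apply: ler_pM K_le_exp => //.
      by apply: mulr_ge0 (expR_ge0 _); exact: ltW.
    apply: ler_pM q_le _; rewrite ?(ltW q0) ?expR_ge0 //.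
    by apply: le_trans expRa_le _; have := G_le; have := G_ge1; lra.
  by rewrite -!expRD -[leRHS]expR0 ler_expR; have := l120; lra.
have K1 := K100.
have qa1 : q * expR a <= 1.
  have : 0 <= q * expR a by apply: mulr_ge0 (expR_ge0 _); exact: ltW.
  by nra.
rewrite rk1; set x := q * expR a in small qa1 *.
have Cn : 'C(n, k.-1)%:R <= C by rewrite ler_nat.
apply: (@le_trans _ _ (C * expR (- x * (N - K)))).
  apply: ler_pM => //; first by apply: exprn_ge0; lra.
  apply: (@le_trans _ _ (expR (- x) ^+ (n - k.-1))).
    by apply: lerXn2r; rewrite ?nnegrE ?expR_ge0 //; [lra|exact: expR_ge1Dx].
  rewrite -expRM_natr ler_expR; apply: ler_wnM2l.
    rewrite oppr_le0; apply: mulr_ge0 (expR_ge0 _); exact: ltW.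
  by rewrite -natrB // ler_nat leq_sub2l // leq_pred.
rewrite CE -expRD.
have h1 : N * q * (1 + a) <= x * N.
  have -> : x * N = N * q * expR a by rewrite /x; ring.
  by apply: ler_wpM2l; [exact: ltW Nq_gt0|exact: expR_ge1Dx].
have h2 : l ^+ 2 / 3%:R <= N * q * a.
  apply: (@le_trans _ _ (K * l / 2 * a)); last first.
    by apply: ler_wpM2r; [exact: ltW|exact: Nq_ge].
  have -> : K * l / 2 * a = a * K * (l / 2) by ring.
  have -> : l ^+ 2 / 3%:R = 2%:R / 3%:R * l * (l / 2) by field.
  by apply: ler_wpM2r rateK_ge; have := l120; lra.
have h3 : 40%:R * l <= l ^+ 2 / 3%:R by have := l120; rewrite expr2; nra.
rewrite -[X in expR X]opprK; apply: inv_l_ge; have := l120; lra.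
Qed.

(** Lets the tail bound for one degree survive the union over [n] vertices. It follows from
    [p >= a / G], [a k >= 2 l / 3] and [3 k G <= n]. *)
Lemma pN_ge : 2 * l <= (1 - r) * N.
Proof.
have a0 := rate_gt0; have g1 := G_ge1; have l0 := l120.
have p_ge : a / G <= 1 - r.
  have h1 := expR_ge1Dx a; have h2 : r * expR a = 1.
    by rewrite /nonedge -expRD addNr expR0.
  have h3 := expRa_le; have r0 : 0 < r := expR_gt0 _.
  rewrite ler_pdivrMr; last lra.
  have : a * r <= (1 - r) * 1 by nra.
  have h4 : 1 <= r * G by rewrite -h2 ler_pM2l.
  by nra.
apply: (@le_trans _ _ (a / G * N)); last first.
  by apply: ler_wpM2r p_ge; exact: ltW N_gt0.
have KG : 3%:R * K * G <= N.
  apply: (@le_trans _ _ (expR (l / 3%:R) * expR (l / 6%:R))).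
    have -> : 3%:R * K * G = K * (3%:R * G) by ring.
    have GG := G_le.
    by apply: ler_pM => //; [exact: K_le_exp|lra].
  by rewrite -expRD [leRHS]NE ler_expR; lra.
have -> : a / G * N = a * K * (N / (K * G)).
  by field; rewrite !lt0r_neq0 // ?expR_gt0 ?K_gt0.
apply: (@le_trans _ _ (2%:R / 3%:R * l * 3%:R)); first by lra.
have KG0 : 0 < K * G by apply: mulr_gt0; [exact: K_gt0|exact: expR_gt0].
apply: ler_pM; rewrite ?rateK_ge //; first by lra.
by rewrite ler_pdivlMr // mulrA.
Qed.

Lemma Gnp_good :
  1 - (1603%:R + 25%:R * delta) / l <=
  EG (fun E => (good k (delta / 64%:R) 2%:R 1 64%:R E)%:R).
Proof.
have [k4 _] := k_range; have N0 := N_gt0; have K0 := K_gt0; have l0 := l_gt0.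
have d0 := degfrac_gt0; have a0 := rate_gt0; have nu0 : 0 < nu := expR_gt0 _.
have n9 : (9 <= n)%N.
  have [_ h] := k_range; apply: leq_trans h; rewrite -(ler_nat R) natrM.
  by have := K100; lra.
(* Chosen so that [16 L k / n] is exactly [delta * l], which is less than [s + 1]. *)
pose L := delta * l * N / (16%:R * K).
have L0 : 0 < L.
  apply: divr_gt0; last by apply: mulr_gt0.
  by apply: mulr_gt0 => //; apply: mulr_gt0.
have r1 : r < 1 by rewrite /nonedge -expR0 ltr_expR oppr_lt0.
have p01 : 0 < 1 - r <= 1.
  by have := expR_gt0 (- a); rewrite -/nonedge => ?; apply/andP; split; lra.
have Hs : 16%:R * L * K / N <= s.+1%:R.
  have -> : 16%:R * L * K / N = delta * l.
    by rewrite /L; field; rewrite !lt0r_neq0.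
  by have /andP[_ /ltW] := trunc_bounds.
have HL : delta / 64%:R * (4%:R * (1 - r) * N) <= L.
  have p_le : (1 - r) * K <= l.
    apply: le_trans rateK_le; apply: ler_wpM2r; first exact: ltW.
    by have := expR_ge1Dx (- a); rewrite -/nonedge; lra.
  rewrite /L ler_pdivlMr; last by apply: mulr_gt0.
  have -> : delta / 64%:R * (4%:R * (1 - r) * N) * (16%:R * K) =
    delta * N * ((1 - r) * K) by field.
  have -> : delta * l * N = delta * N * l by ring.
  by apply: ler_wpM2l => //; apply: mulr_ge0; exact: ltW.
have n1 : (1 < n)%N by apply: leq_trans n9.
have c10 : 0 < delta / 64%:R by apply: divr_gt0.
have rE : r = 1 - (1 - r) by ring.
apply: le_trans (good_prob k_bounds n1 p01 L0 c10 Hs HL rE mu_gt0).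
have m2 : 0 < mu ^+ 2 by apply: exprn_gt0; exact: mu_gt0.
have KN0 : 0 < K / N by apply: divr_gt0.
rewrite lerD2l lerN2.
(* One summand for each failure in [good_prob]: smaller sets, variance (16 * 100), frail pairs,
   degrees, size. *)
have -> : (1603%:R + 25%:R * delta) / l =
  l^-1 + 1600%:R / l + 25%:R * delta / l + l^-1 + l^-1 by ring.
have nul : nu^-1 <= l^-1.
  rewrite lef_pV2 ?posrE //; apply: le_trans l_le_nu _; rewrite ler_expR.
  by have := epsl_gt0; lra.
have pN := pN_ge.
apply: lerD; last first.
  apply: inv_l_ge.
  have N9 : 9%:R <= N by rewrite ler_nat.
  have h : (1 - r) * N * 1 <= (1 - r) * N * ((N - 1) / 8%:R).
    apply: ler_wpM2l; last by lra.
    by apply: mulr_ge0; [have /andP[/ltW] := p01|exact: ltW].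
  by rewrite bin2_natr ?(ltnW n1) //; lra.
apply: lerD; last first.
  by rewrite [X in X * _]NE -expRD -[X in expR X]opprK; apply: inv_l_ge; lra.
apply: lerD; [apply: lerD; first exact: smaller_bound|].
  rewrite ler_pdivrMr; last first.
    by apply: divr_gt0 => //; apply: mulr_gt0.
  apply: le_trans variance_bound _.
  have -> : 1600%:R / l * (K / N * mu ^+ 2 / 100%:R) =
    mu ^+ 2 * (16%:R * (K / N / l)) by field; rewrite !lt0r_neq0.
  apply: ler_wpM2l; first exact: ltW.
  by apply: ler_wpM2l => //; apply: ler_wpM2l nul; exact: ltW.
rewrite ler_pdivrMr; last by apply: divr_gt0.
apply: (@le_trans _ _ (L * (mu ^+ 2 *
    (4%:R * expR (eps * l / 4%:R) * (K / N / nu))))).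
  by apply: ler_wpM2l; [exact: ltW|exact: lowdeg_bound].
have -> : L * (mu ^+ 2 * (4%:R * expR (eps * l / 4%:R) * (K / N / nu))) =
  mu ^+ 2 * (delta / 4%:R) * (l * (expR (eps * l / 4%:R) / nu)).
  by rewrite /L; field; rewrite !lt0r_neq0.
have -> : 25%:R * delta / l * (mu ^+ 2 / 100%:R) =
  mu ^+ 2 * (delta / 4%:R) * l^-1 by field; rewrite lt0r_neq0.
apply: ler_wpM2l.
  by apply: mulr_ge0; [exact: ltW|apply: divr_ge0 => //; exact: ltW].
rewrite -[leRHS]div1r ler_pdivlMr // -expRN -expRD.
have -> : eps * l / 4%:R - eps * l = - (3%:R / 4%:R * (eps * l)) by field.
have e0 := expR_ge0 (- (3%:R / 4%:R * (eps * l))).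
apply: (@le_trans _ _ (expR (eps * l / 2) * expR (- (3%:R / 4%:R * (eps * l))))).
  by rewrite mulrAC -expr2; apply: ler_wpM2r => //; exact: l2_le.
by rewrite -expRD -[leRHS]expR0 ler_expR; have := epsl_gt0; lra.
Qed.

End Estimates.

(** * Passage to the limit *)

Section Asymptotics.
Variable R : realType.

Lemma Gnm_prob_le1 n m (A : pred {set {set 'I_n}}) : Gnm_prob R m A <= 1.
Proof.
rewrite /Gnm_prob; have [->|E0] := eqVneq (Gnm n m) finset.set0.
  by rewrite cards0 invr0 mulr0.
rewrite ler_pdivrMr ?ltr0n ?card_gt0 // mul1r ler_nat subset_leq_card //.
by apply/fintype.subsetP => E; rewrite inE => /andP[].
Qed.

Lemma near_ln_ge (M : R) : \forall n \near \oo%classic, M <= ln (n%:R : R).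
Proof.
near=> n.
have h : expR M <= n%:R by near: n; exact: nbhs_infty_ger.
rewrite -[M]expRK ler_ln ?posrE ?expR_gt0 //.
by apply: lt_le_trans h; exact: expR_gt0.
Unshelve. all: by end_near.
Qed.

(** Write the exponential as a fifth power and use [exp x >= x]: of the five factors [l], the spare
    one beats the constant. *)
Lemma poly_le_expR (e G l : R) : 0 < e -> 0 < l ->
  36%:R * G * (10%:R / e) ^+ 5 <= l -> 36%:R * G * l ^+ 4 <= expR (e * l / 2).
Proof.
move=> e0 l0; rewrite expr_div_n mulrA ler_pdivrMr ?exprn_gt0 // => h.
have -> : e * l / 2 = 5%:R * (e * l / 10%:R) by field.
rewrite expRM_natl.
apply: (@le_trans _ _ ((e * l / 10%:R) ^+ 5)); last first.
  apply: lerXn2r; rewrite ?nnegrE ?expR_ge0 //.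
    by rewrite divr_ge0 // mulr_ge0 // ltW.
  by have := expR_ge1Dx (e * l / 10%:R); lra.
have -> : (e * l / 10%:R) ^+ 5 = l * e ^+ 5 * l ^+ 4 / 10%:R ^+ 5 by field.
by rewrite ler_pdivlMr ?exprn_gt0 // mulrAC ler_wpM2r // exprn_ge0 // ltW.
Qed.

End Asymptotics.

Theorem theorem2p1 (R : realType) (eps : R) (k : nat -> int) :
  0 < eps ->
  (\forall n \near \oo%classic,
     eps * ln (n%:R : R) <= (k n)%:~R <= n%:R `^ (3%:R^-1 - eps)) ->
  exists (m : nat -> nat) (c1 C1 c2 C2 : R),
    [/\ 0 < c1, 0 < C1, 0 < c2, 0 < C2 &
      aas R m (fun n G =>
        let gamma := domination_number G in
        let b : R := (bondage_number G)%:R in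
        let Delta : R := (max_degree G)%:R in
        let mn : R := (m n)%:R / n%:R in
        [&& gamma%:Z == k n,
            c1 * Delta <= b <= C1 * Delta &
            c2 * mn <= Delta <= C2 * mn])].
Proof.
(* The estimates ask for [eps <= 1]; decreasing [eps] only weakens the bounds on [k]. *)
move=> eps0 Hk; pose e := Num.min eps 1.
have e01 : 0 < e <= 1 by rewrite lt_min eps0 ltr01 ge_min lexx orbT.
have e0 : 0 < e by case/andP: e01.
have e_eps : e <= eps by rewrite ge_min lexx.
pose kk n := `|k n|%N; pose c1 := degfrac e / 64%:R.
have c10 : 0 < c1 by rewrite divr_gt0 // degfrac_gt0.
pose good_n n := @good R n (kk n) c1 2%:R 1 64%:R.
pose r n : R := nonedge R n (kk n).
(* The guard allows [m] to be chosen for every [n], although [r n] is known to be a probability only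
   for large [n]. *)
pose P n mn := 0 <= r n <= 1 ->
  Ex (gw (T := 'I_n) (r n)) (fun E => (good_n n E)%:R) <=
  Gnm_prob R mn (good_n n).
have [m Hm] : {m : nat -> nat & forall n, P n (m n)}.
  apply: (@boolp.choice _ _ P) => n.
  have [r01|/negP r01] := boolP (0 <= r n <= 1); last by exists 0%N.
  by have [mn hmn] := Gnm_prob_ge r01 (good_n n); exists mn.
exists m, c1, 2%:R, 1, 64%:R; split=> //; rewrite /aas.
set f := fun n : nat => _.
pose M := 1603%:R + 25%:R * degfrac e.
have M0 : 0 < M by have := degfrac_gt0 e01; rewrite /M; lra.
apply/cvgrPdist_lt => tol tol0; near=> n.
have l0 : 120%:R <= ln (n%:R : R) by near: n; exact: near_ln_ge.
have l1 : 100%:R / e <= ln (n%:R : R) by near: n; exact: near_ln_ge.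
have l2 : 36%:R * expR e^-1 * (10%:R / e) ^+ 5 <= ln (n%:R : R).
  by near: n; exact: near_ln_ge.
have l3 : 2 * M / tol <= ln (n%:R : R) by near: n; exact: near_ln_ge.
have /andP[k1 k2] : eps * ln (n%:R : R) <= (k n)%:~R <= n%:R `^ (3%:R^-1 - eps).
  by near: n.
set l := ln (n%:R : R) in l0 l1 l2 l3 k1 *.
have lpos : 0 < l by lra.
have kpos : 0 <= k n.
  by rewrite -(ler0z R); apply: le_trans k1; rewrite mulr_ge0 // ltW.
have kE : k n = kk n by rewrite /kk gez0_abs.
have kR : (k n)%:~R = (kk n)%:R :> R by rewrite kE pmulrn.
rewrite kR in k1 k2.
have ek : e * l <= (kk n)%:R by apply: le_trans k1; rewrite ler_wpM2r // ltW.
have K100 : 100%:R <= (kk n)%:R :> R.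
  apply: le_trans ek; rewrite ler_pdivrMr // in l1.
  by rewrite mulrC.
have n0 : 0 < n%:R :> R.
  by have [//|/le_trans/(_ ler01)/ln_le0] := ltP 0 (n%:R : R); rewrite -/l; lra.
have Kl3 : 3%:R * (ln (kk n)%:R + e * l) <= l.
  have : ln (kk n)%:R <= (3%:R^-1 - eps) * l.
    rewrite -[leRHS]expRK ler_ln ?posrE ?expR_gt0 //; last by lra.
    by move: k2; rewrite /powR (negbTE (lt0r_neq0 n0)).
  have : e * l <= eps * l by rewrite ler_wpM2r // ltW.
  lra.
have Gl : 36%:R * expR e^-1 * l ^+ 4 <= expR (e * l / 2) by apply: poly_le_expR.
have hr : 0 <= r n <= 1 by apply: (r01 (eps := e)).
have good_lb := le_trans (Gnp_good e01 l0 K100 ek Kl3 Gl) (Hm n hr).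
have fE : f n = Gnm_prob R (m n) (good_n n).
  rewrite /f /Gnm_prob; congr (_%:R / _); apply: eq_card => E; rewrite !inE.
  case: (E \subset _) => //=; case: (#|E| =P m n) => //= Em.
  by rewrite /good_n /good Em kE eqz_nat.
have Ml : M / l < tol.
  rewrite ltr_pdivrMr //; rewrite ler_pdivrMr // in l3; lra.
rewrite ger0_norm ?fE ?subr_ge0 ?Gnm_prob_le1 //.
by move: good_lb; rewrite -/M -/l; lra.
Unshelve. all: by end_near.
Qed.
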